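(* Let $d \geq 2$ and let $\alpha \in \mathbb{R}^d$ be a badly approximable vector. Then there exists a constant $c_{\alpha} > 0$, depending only on $\alpha$ (and $d$), such that for all differentiable functions $f: \mathbb{T}^d \rightarrow \mathbb{R}$ and all integers $N \geq 1$ $$ \left| \int_{\mathbb{T}^d} f(x)\, dx - \frac{1}{N} \sum_{k=1}^{N} f(k \alpha) \right| \leq c_{\alpha}\, \| \nabla f\|^{(d-1)/d}_{L^{\infty}(\mathbb{T}^d)}\, \| \nabla f\|^{1/d}_{L^{2}(\mathbb{T}^d)}\, N^{-1/d}.$$
   Context: $\mathbb{T}^d = \mathbb{R}^d/\mathbb{Z}^d$ with normalized Lebesgue measure $dx$, and $f(k\alpha)$ means $f$ evaluated at $(k\alpha_1,\dots,k\alpha_d) \bmod 1$ (componentwise). A vector $\alpha = (\alpha_1,\dots,\alpha_d) \in \mathbb{R}^d$ is called badly approximable if there is a constant $c > 0$ such that for all positive integers $q$ one has $\max_{1 \leq j \leq d} \| \alpha_j q\| \geq c\, q^{-1/d}$, where $\|s\|$ is the distance from the real number $s$ to the nearest integer. $\|\nabla f\|_{L^p}$ denotes the $L^p$ norm of the Euclidean length $|\nabla f|$; if $\|\nabla f\|_{L^\infty} = \infty$ the inequality is understood to be trivially true. *)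

(* Defs.v *)
From HB Require Import structures.
From mathcomp Require Import all_boot all_order all_algebra.
From mathcomp Require Import all_classical all_reals all_analysis.

Set Implicit Arguments.
Unset Strict Implicit.
Unset Printing Implicit Defensive.

Import Order.TTheory GRing.Theory Num.Theory.
Import numFieldNormedType.Exports.

Local Open Scope classical_set_scope.
Local Open Scope ring_scope.

Section power_probability.
Context d (T : measurableType d) (R : realType) (P : probability T R).

Definition tcons n (p : T * n.-tuple T) : n.+1.-tuple T := [tuple of p.1 :: p.2].

Let measurable_tcons n : measurable_fun [set: T * n.-tuple T] (@tcons n).
Proof. exact: measurable_cons. Qed.

HB.instance Definition _ n :=
  @isMeasurableFun.Build _ _ _ _ (@tcons n) (@measurable_tcons n).

(* P \x ... \x P (n factors); the base case is the point mass on the one-point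
   space 0.-tuple T. *)
Fixpoint power_prob n : probability (n.-tuple T) R :=
  if n is m.+1 return probability (n.-tuple T) R
  then distribution (P \x power_prob m)%E (@tcons m)
  else \d_([tuple] : 0.-tuple T).

End power_probability.

Section torus.
Context (R : realType) (d : nat).

(* The torus R^d/Z^d is represented by the fundamental domain [0, 1]^d, and
   functions on it by Z^d-periodic functions on R^d; dx is the d-fold product
   of the Lebesgue measure on [0, 1].  The measurable space R^d is
   d.-tuple R, the normed space R^d is 'rV[R]_d; rv_of_tuple identifies them. *)
Definition torus_measure : probability (d.-tuple (measurableTypeR R)) R :=
  power_prob (uniform_prob (@ltr01 R)) d.

Definition rv_of_tuple (t : d.-tuple (measurableTypeR R)) : 'rV[R]_d :=
  \row_i tnth t i.

Definition Zperiodic (f : 'rV[R]_d -> R) :=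
  forall (x : 'rV[R]_d) (z : 'rV[int]_d), f (x + map_mx intr z) = f x.

Definition gradient (f : 'rV[R]_d -> R) (x : 'rV[R]_d) : 'rV[R]_d :=
  \row_i 'D_(delta_mx 0 i) f x.

(* The library norm on 'rV[R]_d is the sup norm. *)
Definition euclidean_norm (v : 'rV[R]_d) : R := Num.sqrt (\sum_i v 0 i ^+ 2).

Definition gradient_Lnorm (p : \bar R) (f : 'rV[R]_d -> R) : \bar R :=
  'N[torus_measure]_p[EFin \o euclidean_norm \o gradient f \o rv_of_tuple].

Definition dist_int (s : R) : R := inf (range (fun m : int => `|s - m%:~R|)).

Definition badly_approximable (alpha : 'rV[R]_d) :=
  exists2 c : R, 0 < c & forall q : nat, (0 < q)%N ->
    c * q%:R `^ (- d%:R^-1) <= \big[Num.max/0]_(j < d) dist_int (alpha 0 j * q%:R).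

End torus.

(* Main.v *)
Require Import Defs.
From HB Require Import structures.
From mathcomp Require Import all_boot all_order all_algebra.
From mathcomp Require Import all_classical all_reals all_analysis.
From mathcomp Require Import measurable_realfun ess_sup_inf.
From mathcomp Require Import zify ring lra.
Import Order.TTheory GRing.Theory Num.Theory.
Import numFieldNormedType.Exports.

(** Smooth f at scale 1/n, and solve a divergence equation for what is left.

Let L and M be the essential supremum and the L2 norm of the gradient.  If L is
infinite, so is the right-hand side: M cannot vanish, since otherwise the
gradient would be zero almost everywhere and L would be 0.  So let L be finite.

The gradient need not be continuous, and its bound holds only almost
everywhere; still, f is L-Lipschitz along the coordinate axes
([partial_increment_le]).  On a line that meets the exceptional set in a null
set this is a statement about an everywhere differentiable function of one
variable ([increment_le_ae]); such lines pass arbitrarily close to every point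
([generic_line_avoids_null_set]), and f is continuous.

Let K be a nonnegative trigonometric polynomial of degree n = 2^p, of mean 1,
concentrated at scale 1/n (the Fejer-Korovkin kernel).  Replacing f by its
average against K changes every value by at most 5dL/n ([smoothing_error]).
For the smoothed function, the orbit average minus the mean is the integral of
f against nu - 1, where nu is the average of the translates of K to the points
k alpha.  The trigonometric polynomial nu - 1 has mean zero, so it is - div u
for an explicit vector field u ([potential]), and the difference becomes the
integral of grad f . u ([smoothed_discrepancy]), at most M times the L2 norm
of u.  Summing the geometric progression over the orbit and using orthogonality
of the frequencies,

  |u|^2 <= 2/N^2 * (sum over 0 < |m| <= n of (|m| |sin (pi m.alpha)|)^-2)

([potential_energy]).

Bad approximability enters only here.  By a pigeonhole argument it gives the
dual estimate |m.alpha - m0| >= c |m|^-d ([transference]).  Applied to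
differences of frequencies, this separates the numbers m.alpha modulo 1 with
|m| <= X by a constant times X^-d, so the sum of 1 / sin^2 (pi m.alpha) over
these m is O(X^(2d)); splitting dyadically and using d >= 2, the weighted sum
is O(n^(2d-2)) ([sum_small_denominators]).

Altogether the error is O(L/n + M n^(d-1) / N) ([discrepancy_bound]), and n of
the order of (L N / M)^(1/d) balances the two terms ([optimize_scale]). *)

Set Implicit Arguments.
Unset Strict Implicit.
Unset Printing Implicit Defensive.

Local Open Scope ring_scope.

(** * Transference *)

Lemma dist_int_le (R : realType) (s : R) (p : int) : dist_int s <= `|s - p%:~R|.
Proof.
apply: ge_inf; last by exists p.
by exists 0 => _ [q _ <-].
Qed.

(** If m.alpha is close to m0, a simultaneous approximation of the coordinates
other than i determines one of coordinate i, provided that the integer p_i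
which solves the linear equation exists.  Hence the pigeonholes record, besides
the position of q alpha_j (j <> i) up to 1/r, also the residue modulo m_i of
the quantity that m_i has to divide. *)
Lemma pigeonhole_transference (R : realType) d (alpha : 'rV[R]_d.+1)
    (m : 'rV[int]_d.+1) (m0 : int) (i : 'I_d.+1) (r : nat) :
  m 0 i != 0 -> (0 < r)%N ->
  exists2 q : nat, (0 < q <= `|m 0%R i| * r ^ d)%N &
  exists p : 'I_d.+1 -> int,
    (forall j, j != i -> `|q%:R * alpha 0 j - (p j)%:~R| < r%:R^-1) /\
    \sum_j m 0 j * p j = q%:Z * m0.
Proof.
move=> mi0; case: r => // r _.
set A := `|m 0%R i|%N.
have A0 : (0 < A)%N by rewrite /A absz_gt0.
pose P (q : nat) j := Num.floor (q%:R * alpha 0 j).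
pose fr (q : nat) j : R := q%:R * alpha 0 j - (P q j)%:~R.
have fr01 q j : 0 <= fr q j < 1.
  have := Num.Theory.floor_itv (q%:R * alpha 0 j).
  by rewrite /fr /P intrD; lra.
(* The integer that has to be divisible by m_i for the equation to be solvable in p_i. *)
pose S (q : nat) : int := q%:Z * m0 - \sum_(j | j != i) m 0 j * P q j.
have Slt q : (`|(S q %% m 0%R i)%Z|%N < A)%N.
  rewrite /A; have := ltz_mod (S q) mi0; have := modz_ge0 (S q) mi0; lia.
pose cell (q : 'I_(A * r.+1 ^ d).+1) : {ffun 'I_d -> 'I_r.+1} * 'I_A :=
  ([ffun j => inord (Num.truncn (r.+1%:R * fr q (lift i j)))], Ordinal (Slt q)).
have /injectivePn [q1 [q2 q12]] : ~~ injectiveb cell.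
  apply/negP => /injectiveP /leq_card.
  by rewrite card_prod card_ffun !card_ord mulnC ltnn.
wlog lt12 : q1 q2 q12 / (q1 < q2)%N.
  move=> H; case: (ltngtP q1 q2) => [|lt21 e|/val_inj e]; first exact: H.
    by apply: (H q2 q1) => //; rewrite eq_sym.
  by rewrite e eqxx in q12.
case=> /ffunP ecell eS.
exists (q2 - q1)%N.
  rewrite subn_gt0 lt12 /=; have := ltn_ord q2; lia.
have trunc_lt q j : (Num.truncn (r.+1%:R * fr q j) < r.+1)%N.
  rewrite -(ltr_nat R); have /andP[f0 f1] := fr01 q j.
  apply: le_lt_trans (_ : r.+1%:R * fr q j < _).
    by apply: (andP (Num.Theory.truncn_itv _)).1; rewrite mulr_ge0.
  by rewrite gtr_pMr.
have close j : j != i -> `|fr q2 j - fr q1 j| < r.+1%:R^-1.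
  rewrite eq_sym => ji; case: (unlift_some ji) => j' -> _.
  have := ecell j'; rewrite !ffunE => /(congr1 val) /=; rewrite !inordK ?trunc_lt // => et.
  have /andP[f0 _] := fr01 q1 (lift i j'); have /andP[g0 _] := fr01 q2 (lift i j').
  have /andP[] := Num.Theory.truncn_itv (mulr_ge0 (ler0n R r.+1) f0).
  have /andP[] := Num.Theory.truncn_itv (mulr_ge0 (ler0n R r.+1) g0).
  rewrite -et; set t := Num.truncn _; rewrite -[t.+1%:R]natr1 => a1 a2 b1 b2.
  rewrite -(ltr_pM2l (ltr0Sn R r)) mulfV ?pnatr_eq0 // -[X in X * `|_|]ger0_norm // -normrM.
  by rewrite mulrBr ltr_norml; apply/andP; split; lra.
have dv : (m 0%R i %| S q2 - S q1)%Z.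
  rewrite -eqz_mod_dvd; apply/eqP.
  have := modz_ge0 (S q1) mi0; have := modz_ge0 (S q2) mi0; lia.
have /dvdzP [pi' epi] := dv.
exists (fun j => if j == i then pi' else P q2 j - P q1 j); split.
  move=> j ji; rewrite (negbTE ji) natrB ?(ltnW lt12) //.
  by have := close _ ji; congr (`|_| < _); rewrite /fr intrB; ring.
rewrite (bigD1 i) //= eqxx mulrC -epi.
under eq_bigr => j ji do rewrite (negbTE ji) mulrBr.
rewrite sumrB /S -subzn ?(ltnW lt12) //; ring.
Qed.

(** Khintchine's transference from simultaneous approximation to one linear form.
A very small value of the form m.alpha - m0 would, by
[pigeonhole_transference], produce some q for which all the q alpha_j are
closer to integers than bad approximability allows. *)
Lemma transference (R : realType) d (alpha : 'rV[R]_d) :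
  badly_approximable alpha ->
  exists2 c : R, 0 < c & forall (m : 'rV[int]_d) (X : nat) (m0 : int),
    m != 0 -> (forall j, `|m 0%R j| <= X)%N ->
    c / X%:R ^+ d <= `|\sum_j (m 0 j)%:~R * alpha 0 j - m0%:~R|.
Proof.
case: d alpha => [|d] alpha [c c0 bad].
  by exists 1 => // m X m0 /eqP []; apply/rowP; case.
(* With r = s * |m_i| boxes per coordinate, s is large enough that twice the
   dimension divided by r stays below
   the bad approximability bound for every q that the pigeonhole principle may return. *)
pose s := (Num.truncn ((2 * d.+1%:R / c) ^+ d.+1)).+1.
have sP : (2 * d.+1%:R / c) ^+ d.+1 <= s%:R.
  apply/ltW; apply: (andP (Num.Theory.truncn_itv _)).2.
  by rewrite exprn_ge0 // divr_ge0 ?mulr_ge0 // ltW.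
have s0 : 0 < s%:R :> R by rewrite ltr0n.
exists (s%:R ^- d.+1); first by rewrite invr_gt0 exprn_gt0.
move=> m X m0 mn0 mX.
(* The largest coefficient, so that errors in the other coordinates are not amplified
   when the form is solved for y_i. *)
pose i := [arg max_(i > ord0) `|m 0%R i|%N].
have imax j : (`|m 0%R j| <= `|m 0%R i|)%N.
  by rewrite /i; case: arg_maxnP => // k _; apply.
set A := `|m 0%R i|%N in imax.
have mi0 : m 0 i != 0.
  apply: contra mn0 => /eqP mi; apply/eqP/rowP => j; rewrite mxE.
  by have := imax j; rewrite /A mi absz0 leqn0 absz_eq0 => /eqP.
have A0 : (0 < A)%N by rewrite /A absz_gt0.
have AR : 0 < A%:R :> R by rewrite ltr0n.
have r0 : (0 < s * A)%N by rewrite muln_gt0.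
set r := (s * A)%N in r0.
have rR : 0 < r%:R :> R by rewrite ltr0n.
have [q /andP[q0 qQ] [p [pclose psum]]] := pigeonhole_transference alpha m0 mi0 r0.
set eps : R := `| _ |.
have qR : 0 < q%:R :> R by rewrite ltr0n.
have qQR : q%:R <= A%:R * r%:R ^+ d :> R by rewrite -natrX -natrM ler_nat.
pose y j := q%:R * alpha 0 j - (p j)%:~R.
have ysum : \sum_j (m 0 j)%:~R * y j = q%:R * (\sum_j (m 0 j)%:~R * alpha 0 j - m0%:~R).
  have /(congr1 (intmul (1 : R))) := psum; rewrite intrM -pmulrn mulrBr => <-.
  rewrite rmorph_sum mulr_sumr -sumrB; apply: eq_bigr => j _.
  by rewrite /y /= intrM; ring.
have yi : `|y i| <= q%:R * eps / A%:R + d%:R / r%:R.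
  have miA : `|(m 0 i)%:~R : R| = A%:R by rewrite /A pmulrn abszE intr_norm.
  have -> : q%:R * eps / A%:R + d%:R / r%:R = (q%:R * eps + A%:R * (d%:R / r%:R)) / A%:R.
    by field; rewrite !gt_eqF.
  rewrite ler_pdivlMr // mulrC -{1}miA -normrM.
  have -> : (m 0 i)%:~R * y i = \sum_j (m 0 j)%:~R * y j - \sum_(j | j != i) (m 0 j)%:~R * y j.
    by rewrite (bigD1 i) //=; ring.
  rewrite ysum (le_trans (ler_normB _ _)) // lerD //.
    by rewrite normrM ger0_norm.
  apply: le_trans (ler_norm_sum _ _ _) _.
  apply: le_trans (_ : \sum_(j | j != i) A%:R / r%:R <= _).
    apply: ler_sum => j ji; rewrite normrM ler_pM //; last exact/ltW/pclose.
    by rewrite -intr_norm -abszE -pmulrn ler_nat imax.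
  rewrite sumr_const -mulr_natl.
  rewrite (_ : #|_| = d)%N; first by rewrite le_eqVlt; apply/orP; left; apply/eqP; ring.
  rewrite -[RHS]/(d.+1.-1) -[in RHS](card_ord d.+1) -(cardC1 i).
  by apply: eq_card => j; rewrite !inE.
have h0 : 0 <= q%:R * eps / A%:R by rewrite divr_ge0 // mulr_ge0 // normr_ge0.
have ylt : c * q%:R `^ (- d.+1%:R^-1) <= q%:R * eps / A%:R + d.+1%:R / r%:R.
  apply: le_trans (bad q q0) _; apply/bigmax_leP; split.
    by rewrite addr_ge0 // divr_ge0.
  move=> j _; rewrite [alpha _ _ * _]mulrC.
  apply: le_trans (dist_int_le _ (p j)) _.
  case: (eqVneq j i) => [->|ji].
    by apply: le_trans yi _; rewrite lerD2l ler_pM2r ?invr_gt0 // ler_nat.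
  apply: le_trans (ltW (pclose j ji)) _.
  have : r%:R^-1 <= d.+1%:R / r%:R :> R by rewrite ler_peMl ?invr_ge0 ?ler1n.
  lra.
have big : 2 * d.+1%:R / r%:R <= c * q%:R `^ (- d.+1%:R^-1).
  rewrite -(@ler_pXn2r _ d.+1) ?nnegrE ?mulr_ge0 ?invr_ge0 ?powR_ge0 ?(ltW c0) //.
  rewrite [X in _ <= X]exprMn -[X in _ <= _ * X]powR_mulrn ?powR_ge0 //.
  rewrite -powRrM mulNr mulVf ?pnatr_eq0 // powRN powRr1 ?ler0n //.
  rewrite ler_pdivlMr //; apply: le_trans (ler_wpM2l _ qQR) _.
    by rewrite exprn_ge0 // mulr_ge0 ?invr_ge0 ?mulr_ge0.
  have -> : (2 * d.+1%:R / r%:R) ^+ d.+1 * (A%:R * r%:R ^+ d)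
         = c ^+ d.+1 * ((2 * d.+1%:R / c) ^+ d.+1 * (A%:R / r%:R)) :> R.
    rewrite !expr_div_n [r%:R ^+ d.+1]exprS; field.
    by rewrite ?expf_neq0 ?gt_eqF.
  rewrite ler_piMr ?exprn_ge0 ?(ltW c0) //.
  by rewrite mulrA ler_pdivrMr // mul1r /r natrM ler_pM2r.
have : d.+1%:R / r%:R <= q%:R * eps / A%:R.
  have : 2 * d.+1%:R / r%:R = d.+1%:R / r%:R + d.+1%:R / r%:R :> R by ring.
  lra.
rewrite ler_pdivlMr // mulrAC ler_pdivrMr // => h.
have AX : A%:R <= X%:R :> R by rewrite ler_nat mX.
have XR : 0 < X%:R :> R by exact: lt_le_trans AX.
rewrite ler_pdivrMr ?exprn_gt0 // -[X in X <= _]mul1r ler_pdivrMr ?exprn_gt0 //.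
have : A%:R <= eps * r%:R ^+ d.+1 * A%:R.
  apply: le_trans (_ : d.+1%:R * A%:R <= _); first by rewrite ler_peMl ?ler1n.
  apply: le_trans h _; rewrite exprS.
  have := ler_wpM2l (mulr_ge0 (normr_ge0 _ : 0 <= eps) (ltW rR)) qQR.
  by congr (_ <= _); ring.
rewrite -[X in X <= _]mul1r ler_pM2r // => h1.
apply: le_trans h1 _; rewrite -mulrA ler_wpM2l ?normr_ge0 //.
rewrite /r natrM exprMn mulrC ler_pM2r ?exprn_gt0 //.
by rewrite lerXn2r ?nnegrE ?ler0n.
Qed.

(** * Small denominators *)

Lemma sin_pi_ge (R : realType) (x : R) : 0 <= x <= 1 / 2 -> x <= sin (pi * x).
Proof.
case/andP; rewrite le_eqVlt => /orP[/eqP<- _|x0 x2]; first by rewrite mulr0 sin0.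
have pi2 := pi_ge2 R.
set u := pi * x.
have u0 : 0 < u by rewrite mulr_gt0 ?pi_gt0.
have u2 : u <= pi / 2 by rewrite /u ler_pM2l ?pi_gt0 //; lra.
have [|xi xiu] := @MVT R (@sin R) (@cos R) 0 u u0 (fun x _ => is_derive_sin x).
  by apply: continuous_subspaceT => y; apply: continuous_sin.
rewrite sin0 !subr0 => e.
have xiu' : 0 < xi < u by move: xiu; rewrite in_itv.
have cu : cos u <= cos xi.
  apply/ltW; rewrite ltr_cos ?in_itv /=; lra.
(* If cos u >= 1/2 the mean value theorem gives sin u >= u / 2; otherwise sin u is at
   least sqrt 3 / 2, while x <= 1/2. *)
have [c2|c2] := lerP (1 / 2) (cos u).
  have : u / 2 <= sin u.
    rewrite e mulrC ler_pM2r //; lra.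
  rewrite /u; nra.
have c0 : 0 <= cos u by apply: cos_ge0_pihalf; lra.
have s0 : 0 <= sin u by apply: sin_ge0_pi; lra.
have := cos2Dsin2 u; nra.
Qed.

Lemma norm_sinDpin (R : realType) (x : R) (n : nat) :
  `|sin (x + pi * n%:R)| = `|sin x|.
Proof.
rewrite mulr_natr; elim: n => [|n IH]; first by rewrite mulr0n addr0.
by rewrite mulrSr addrA sinDpi normrN.
Qed.

Lemma norm_sinDpiz (R : realType) (x : R) (z : int) :
  `|sin (x + pi * z%:~R)| = `|sin x|.
Proof.
case: z => n; first exact: norm_sinDpin.
rewrite NegzE mulrNz mulrN -[in RHS](subrK (pi * n.+1%:R) x).
by rewrite norm_sinDpin.
Qed.

Lemma nearest_int (R : realType) (x : R) : exists z : int, `|x - z%:~R| <= 1 / 2.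
Proof.
exists (Num.floor (x + 1 / 2)).
have := Num.Theory.floor_itv (x + 1 / 2); rewrite intrD => /andP[a b].
rewrite ler_norml; apply/andP; split; lra.
Qed.

Lemma norm_sin_pi_ge (R : realType) (x : R) (z : int) :
  `|x - z%:~R| <= 1 / 2 -> `|x - z%:~R| <= `|sin (pi * x)|.
Proof.
move=> xz.
rewrite -(norm_sinDpiz (pi * x) (- z)) mulrNz -mulrDr.
case: (lerP 0 (x - z%:~R)) xz => [h|h] xz.
  rewrite ger0_norm // in xz *.
  by apply: le_trans (sin_pi_ge _) (ler_norm _); rewrite h.
rewrite ltr0_norm // in xz *; rewrite -[`|sin _|]normrN -sinN -mulrN.
by apply: le_trans (sin_pi_ge _) (ler_norm _); lra.
Qed.

(** Telescoping: k^-2 is at most 1/(k-1) - 1/k for k >= 2. *)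
Lemma sum_inv_sqr (R : realType) (n : nat) :
  \sum_(1 <= k < n.+2) (k%:R ^- 2 : R) <= 2 - n.+1%:R^-1.
Proof.
elim: n => [|n IH]; first by rewrite big_nat1 expr1n invr1; lra.
rewrite big_nat_recr //=; apply: le_trans (lerD IH (lexx _)) _.
have n0 : 0 < n.+1%:R :> R by rewrite ltr0n.
have a0 : 0 < n.+2%:R :> R by rewrite ltr0n.
have -> : 2 - n.+2%:R^-1 = 2 - n.+1%:R^-1 + (n.+1%:R * n.+2%:R)^-1 :> R.
  have e : n.+2%:R = n.+1%:R + 1 :> R by rewrite natr1.
  by field; rewrite ?e; apply/andP; split; lra.
rewrite lerD2l lef_pV2 ?posrE ?exprn_gt0 ?mulr_gt0 //.
by rewrite expr2 ler_pM2r // ler_nat.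
Qed.

(** Rounding r_i / delta down gives distinct positive integers. *)
Lemma sum_inv_sqr_spaced (R : realType) (I : finType) (P : pred I)
    (r : I -> R) (delta : R) : 0 < delta ->
  (forall i, P i -> delta <= r i) ->
  (forall i j, P i -> P j -> i != j -> delta <= `|r i - r j|) ->
  \sum_(i | P i) (r i) ^- 2 <= 2 / delta ^+ 2.
Proof.
move=> d0 rd rr.
pose b i := Num.truncn (r i / delta).
have bP i : P i -> (b i)%:R * delta <= r i < (b i).+1%:R * delta.
  move=> Pi; rewrite -ler_pdivlMr // -ltr_pdivrMr //; apply: Num.Theory.truncn_itv.
  by rewrite divr_ge0 ?(ltW d0) // (le_trans (ltW d0)) ?rd.
have b1 i : P i -> (0 < b i)%N.
  move=> Pi; rewrite -(ltr_nat R) -(ltrD2r 1) add0r natr1 -(ltr_pM2r d0) mul1r.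
  by apply: le_lt_trans (rd i Pi) _; case/andP: (bP i Pi).
pose B := \max_(i | P i) b i.
have bB i : P i -> (b i < B.+1)%N by move=> Pi; rewrite ltnS; apply: leq_bigmax_cond.
rewrite (partition_big (fun i => inord (b i) : 'I_B.+1) predT) //=.
apply: le_trans (_ : \sum_(k < B.+1 | (0 < k)%N) (k%:R ^- 2 / delta ^+ 2) <= _).
  rewrite [X in _ <= X]big_mkcond /=; apply: ler_sum => k _.
  case: (pickP (fun i => P i && (inord (b i) == k))) => [i /andP[Pi /eqP ik]|none]; last first.
    by rewrite big_pred0 //; case: ifP => // _; rewrite divr_ge0 ?invr_ge0 ?exprn_ge0 // ltW.
  have ebk : b i = k by rewrite -ik inordK ?bB.
  rewrite (big_pred1 i) => [|j]; last first.
    apply/andP/eqP => [[Pj /eqP jk]|->]; last by rewrite Pi ik.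
    apply/eqP; apply: contraT => ji.
    have ebj : b j = k by rewrite -jk inordK ?bB.
    have := rr _ _ Pj Pi ji.
    have /andP[] := bP i Pi; have /andP[] := bP j Pj.
    rewrite ebj ebk -natr1 mulrDl mul1r => h1 h2 h3 h4.
    by rewrite leNgt ltr_norml; case/negP; apply/andP; split; lra.
  rewrite -ebk b1 // -invfM -exprMn lef_pV2 ?posrE ?exprn_gt0 ?mulr_gt0 ?ltr0n ?b1 //.
    rewrite lerXn2r ?nnegrE //; first by rewrite mulr_ge0 // ltW.
      by rewrite (le_trans (ltW d0)) ?rd.
    by case/andP: (bP i Pi).
  by rewrite (lt_le_trans d0) ?rd.
rewrite -mulr_suml ler_pM2r ?invr_gt0 ?exprn_gt0 //.
have : \sum_(1 <= k < B.+2) (k%:R ^- 2 : R) <= 2.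
  by apply: le_trans (sum_inv_sqr _ _) _; rewrite gerBl invr_ge0.
apply: le_trans.
rewrite big_mkcond /= -(big_mkord xpredT (fun k => if (0 < k)%N then (k%:R ^- 2 : R) else 0)).
rewrite big_ltn //= add0r [X in _ <= X]big_nat_recr //=.
rewrite (eq_big_nat _ _ (F2 := fun k => k%:R ^- 2)) => [|k /andP[-> _] //].
by rewrite lerDl invr_ge0 exprn_ge0.
Qed.

Section SmallDenominators.
Variables (R : realType) (d : nat) (alpha : 'rV[R]_d).

Definition mdot (m : 'rV[int]_d) (y : 'rV[R]_d) : R := \sum_j (m 0 j)%:~R * y 0 j.

Definition mnorm (m : 'rV[int]_d) : nat := \max_j `|m 0%R j|%N.

Lemma mnorm_le (m : 'rV[int]_d) j : (`|m 0%R j| <= mnorm m)%N.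
Proof. exact: (leq_bigmax (F := fun j => `|m 0%R j|%N)). Qed.

Lemma mnorm_eq0 (m : 'rV[int]_d) : (mnorm m == 0%N) = (m == 0).
Proof.
apply/eqP/eqP => [h|->].
  by apply/rowP => j; rewrite mxE; have := mnorm_le m j; rewrite h leqn0 absz_eq0 => /eqP.
by rewrite /mnorm big1 // => j _; rewrite mxE.
Qed.

Lemma mnormB (m m' : 'rV[int]_d) : (mnorm (m - m') <= mnorm m + mnorm m')%N.
Proof.
apply/bigmax_leqP => j _; rewrite !mxE.
by have := mnorm_le m j; have := mnorm_le m' j; set a := m 0 j; set b := m' 0 j; lia.
Qed.

Lemma mdotB m m' y : mdot (m - m') y = mdot m y - mdot m' y.
Proof.
by rewrite /mdot -sumrB; apply: eq_bigr => j _; rewrite !mxE intrB mulrBl.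
Qed.

Variable c : R.
Hypothesis c0 : 0 < c.
Hypothesis dioph : forall (m : 'rV[int]_d) (X : nat) (m0 : int),
    m != 0 -> (forall j, `|m 0%R j| <= X)%N ->
    c / X%:R ^+ d <= `|mdot m alpha - m0%:~R|.

Variables (I : finType) (nu : I -> 'rV[int]_d).
Hypothesis nu_inj : injective nu.

(** Differences of frequencies in the box of size X lie in the box of size 2X, so
the Diophantine hypothesis separates the representatives of the m.alpha in
[-1/2, 1/2] from each other and from 0.  The factor 4 counts the constant 2
of [sum_inv_sqr_spaced] on each side of 0. *)
Lemma sum_small_denominators_box X : (0 < X)%N ->
  \sum_(i | (0 < mnorm (nu i) <= X)%N) `|sin (pi * mdot (nu i) alpha)| ^- 2
    <= 4 * (X%:R * 2) ^+ (2 * d) / c ^+ 2.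
Proof.
move=> X0.
pose th i := mdot (nu i) alpha.
have [z zP] : exists z : I -> int, forall i, `|th i - (z i)%:~R| <= 1 / 2.
  exists (fun i => xchoose (nearest_int (th i))) => i.
  exact: xchooseP (nearest_int (th i)).
pose r i := th i - (z i)%:~R.
pose P i := (0 < mnorm (nu i) <= X)%N.
pose delta := c / (X%:R * 2) ^+ d.
have X2 : 0 < X%:R * 2 :> R by rewrite mulr_gt0 ?ltr0n.
have delta0 : 0 < delta by rewrite divr_gt0 ?exprn_gt0.
have rd i : P i -> delta <= `|r i|.
  case/andP=> i0 iX; rewrite /delta -natrM; apply: dioph.
    by rewrite -mnorm_eq0 -lt0n.
  move=> j; apply: leq_trans (mnorm_le _ _) _; lia.
have rr i j : P i -> P j -> i != j -> delta <= `|r i - r j|.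
  case/andP=> i0 iX /andP[j0 jX] ij.
  have -> : r i - r j = mdot (nu i - nu j) alpha - (z i - z j)%:~R.
    by rewrite mdotB intrB /r /th; ring.
  rewrite /delta -natrM; apply: dioph.
    by rewrite subr_eq0; apply: contra ij => /eqP /nu_inj ->.
  by move=> k; apply: leq_trans (mnorm_le _ _) _; apply: leq_trans (mnormB _ _) _; lia.
apply: le_trans (_ : \sum_(i | P i) (r i) ^- 2 <= _).
  apply: ler_sum => i Pi; rewrite -[r i ^+ 2]real_normK ?num_real //.
  have ri : 0 < `|r i| by apply: lt_le_trans (rd i Pi).
  have rs : `|r i| <= `|sin (pi * th i)| by apply: norm_sin_pi_ge.
  by rewrite lef_pV2 ?posrE ?exprn_gt0 ?(lt_le_trans ri) // lerXn2r ?nnegrE.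
have -> : 4 * (X%:R * 2) ^+ (2 * d) / c ^+ 2 = 2 / delta ^+ 2 + 2 / delta ^+ 2.
  rewrite /delta expr_div_n invf_div -exprM mulnC; ring.
rewrite (bigID (fun i => 0 < r i)) /=; apply: lerD.
  apply: sum_inv_sqr_spaced => // [i /andP[Pi ri]|i j /andP[Pi _] /andP[Pj _]].
    by rewrite -[r i]gtr0_norm ?rd.
  exact: rr.
under eq_bigr => i _ do rewrite -sqrrN.
apply: sum_inv_sqr_spaced => // [i /andP[Pi ri]|i j /andP[Pi _] /andP[Pj _] ij].
  by rewrite -[- r i]ler0_norm ?rd // leNgt.
by rewrite -opprD normrN rr.
Qed.

(** On the dyadic block of frequencies between 2^p and 2^(p+1) the weight is at
most 4^-p, so the block contributes as much as the bound claimed for the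
smaller box; the total still at most doubles when the bound is multiplied by
2^(2d-2) >= 2. *)
Lemma sum_small_denominators p : (1 < d)%N ->
  \sum_(i | (0 < mnorm (nu i) <= 2 ^ p)%N)
     ((mnorm (nu i))%:R * `|sin (pi * mdot (nu i) alpha)|) ^- 2
    <= 4 * 4 ^+ (2 * d) / c ^+ 2 * (2 ^+ p) ^+ (2 * d - 2).
Proof.
move=> d1; elim: p => [|p IH].
  rewrite expr1n mulr1; apply: le_trans (_ : 4 * (1%:R * 2) ^+ (2 * d) / c ^+ 2 <= _).
    apply: le_trans (sum_small_denominators_box (leqnn 1)).
    rewrite expn0; apply: ler_sum => i /andP[i0 i1].
    have e1 : mnorm (nu i) = 1%N by lia.
    by rewrite e1 mul1r.
  rewrite ler_pM2r ?invr_gt0 ?exprn_gt0 // ler_pM2l // lerXn2r ?nnegrE //; lra.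
set K := _ / c ^+ 2 in IH *.
have K0 : 0 <= K by rewrite divr_ge0 ?mulr_ge0 ?exprn_ge0 // ltW.
rewrite (bigID (fun i => (mnorm (nu i) <= 2 ^ p)%N)) /=.
have p0 : 0 < 2 ^+ p :> R by rewrite exprn_gt0.
apply: le_trans (_ : K * (2 ^+ p) ^+ (2 * d - 2) + K * (2 ^+ p) ^+ (2 * d - 2) <= _); last first.
  rewrite [2 ^+ p.+1]exprS exprMn.
  have h : 2 <= 2 ^+ (2 * d - 2) :> R.
    rewrite -[X in X <= _]expr1 ler_eXn2l ?ltr1n //; lia.
  have : 0 <= K * (2 ^+ p) ^+ (2 * d - 2) by rewrite mulr_ge0 ?exprn_ge0 // ltW.
  nra.
apply: lerD.
  apply: le_trans IH; rewrite le_eqVlt; apply/orP; left; apply/eqP.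
  apply: eq_bigl => i; have := leq_pexp2l (isT : (0 < 2)%N) (leqnSn p); lia.
apply: le_trans (_ : \sum_(i | (0 < mnorm (nu i) <= 2 ^ p.+1)%N)
    (2 ^+ p) ^- 2 * `|sin (pi * mdot (nu i) alpha)| ^- 2 <= _).
  rewrite [X in _ <= X](bigID (fun i => (mnorm (nu i) <= 2 ^ p)%N)) /=.
  apply: ler_wpDl.
    by apply: sumr_ge0 => i _; rewrite mulr_ge0 ?invr_ge0 ?exprn_ge0.
  apply: ler_sum => i /andP[_ ip].
  rewrite exprMn invfM ler_wpM2r ?invr_ge0 ?exprn_ge0 //.
  have pm : 2 ^+ p <= (mnorm (nu i))%:R :> R by rewrite -natrX ler_nat; lia.
  have m0 := lt_le_trans p0 pm.
  by rewrite lef_pV2 ?posrE ?(exprn_gt0 _ m0) ?(exprn_gt0 _ p0) // lerXn2r ?nnegrE // ltW.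
rewrite -mulr_sumr mulrC ler_pdivrMr ?exprn_gt0 //.
apply: le_trans (sum_small_denominators_box _) _; first by rewrite expn_gt0.
rewrite le_eqVlt; apply/orP; left; apply/eqP.
rewrite /K natrX exprS -mulrA -[RHS]mulrA -exprD subnK; last lia.
rewrite [2 * _ * 2](_ : _ = 4 * 2 ^+ p :> R); last by ring.
by rewrite exprMn; ring.
Qed.

End SmallDenominators.

(** * Translations of the torus *)

Section LineTranslation.
Local Open Scope classical_set_scope.
Local Open Scope ereal_scope.
Variable R : realType.
Local Notation mu := (@lebesgue_measure R).
Local Notation RT := (measurableTypeR R).

Definition line_shift (a : R) : RT -> RT := fun x => (x + a)%R.

Lemma measurable_line_shift (a : R) : measurable_fun setT (line_shift a).
Proof. by apply: measurable_funD. Qed.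

HB.instance Definition _ (a : R) :=
  @isMeasurableFun.Build _ _ _ _ (line_shift a) (measurable_line_shift a).

Lemma lebesgue_measure_shift (a : R) (A : set R) : measurable A ->
  pushforward mu (line_shift a) A = mu A.
Proof.
move=> mA; apply/esym/lebesgue_measure_unique => //= _ [[b c]] _ <-.
rewrite /pushforward.
have -> : line_shift a @^-1` `]b, c] = `](b - a)%R, (c - a)%R]%classic.
  by apply/seteqP; split=> x /=; rewrite !in_itv /= /line_shift ltrBlDr lerBrDr.
rewrite !lebesgue_measure_itv /= !lte_fin ltrD2r.
by case: ifP => // _; rewrite -!EFinB; congr (_%:E); rewrite /=; ring.
Qed.

Lemma ge0_integral_line_shift (a : R) (D : set R) (f : R -> \bar R) :
  measurable D -> measurable_fun setT f -> (forall x, 0 <= f x) ->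
  \int[mu]_(x in line_shift a @^-1` D) f (x + a)%R = \int[mu]_(x in D) f x.
Proof.
move=> mD mf f0; rewrite -(ge0_integral_pushforward (measurable_line_shift a)) //.
  by apply: eq_measure_integral => A mA _; apply: lebesgue_measure_shift.
exact: measurable_funTS.
Qed.

Lemma periodic_int (T : Type) (f : R -> T) : (forall x, f (x + 1)%R = f x) ->
  forall (z : int) x, f (x + z%:~R)%R = f x.
Proof.
move=> fp.
have fn (n : nat) x : f (x + n%:R)%R = f x.
  by elim: n => [|n IH]; rewrite ?addr0 // -natr1 addrA fp.
case=> n x; first exact: fn.
by rewrite NegzE mulrNz -[in RHS](subrK (n.+1%:R)%R x) fn.
Qed.

(** Periodicity reduces to a shift b in [0, 1); the interval ]b, 1+b] is then cut
at 1 and the piece beyond 1 is moved back by a period. *)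
Lemma ge0_integral_periodic_shift (a : R) (f : R -> \bar R) :
  measurable_fun setT f -> (forall x, 0 <= f x) -> (forall x, f (x + 1)%R = f x) ->
  \int[mu]_(x in `[0%R, 1%R]) f (x + a)%R = \int[mu]_(x in `[0%R, 1%R]) f x.
Proof.
move=> mf f0 fp.
pose b := (a - (Num.floor a)%:~R)%R.
have b01 : (0 <= b < 1)%R.
  by have := Num.Theory.floor_itv a; rewrite /b intrD => /andP[h1 h2]; apply/andP; split; lra.
case/andP: b01 => b0 b1.
rewrite (_ : (fun x => f (x + a)%R) = (fun x => f (x + b)%R)); last first.
  apply/funext => x; rewrite -[RHS](periodic_int fp (Num.floor a)).
  by congr f; rewrite /b; ring.
rewrite -(integral_itv_obnd_cbnd (f := fun x => f (x + b)%R)); last first.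
  apply: measurable_funTS; apply: (measurableT_comp mf); exact: measurable_line_shift.
rewrite -(integral_itv_obnd_cbnd (f := f)); last exact: measurable_funTS.
have -> : \int[mu]_(x in `]0%R, 1%R]) f x =
    \int[mu]_(x in `]0%R, b]) f x + \int[mu]_(x in `]b, 1%R]) f x.
  have -> : `]0%R, 1%R]%classic = `]0%R, b] `|` `]b, 1%R] :> set R.
    by rewrite -itv_bndbnd_setU ?bnd_simp // ltW.
  rewrite ge0_integral_setU //; last 2 first.
  - exact: measurable_funTS.
  by apply/disj_setPS => x /= [] /[!in_itv] /= /andP[_ h1] /andP[h2 _]; lra.
have -> : `]0%R, 1%R]%classic = line_shift b @^-1` (`]b, 1%R] `|` `]1%R, (1 + b)%R]).
  apply/seteqP; split=> x /=; rewrite /line_shift !in_itv /=.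
    by move=> /andP[x0 x1]; have [h|h] := lerP (x + b) 1; [left|right]; apply/andP; split; lra.
  by case=> /andP[h1 h2]; apply/andP; split; lra.
rewrite ge0_integral_line_shift //; last exact: measurableU.
rewrite ge0_integral_setU //; last 2 first.
- exact: measurable_funTS.
- by apply/disj_setPS => x /= [] /[!in_itv] /= /andP[_ h1] /andP[h2 _]; lra.
rewrite addeC; congr (_ + _).
rewrite -[LHS](ge0_integral_line_shift 1) //.
under eq_integral => x _ do rewrite fp.
congr (integral _ _ _); apply/seteqP; split=> x /=; rewrite /line_shift !in_itv /=;
  by case/andP=> h1 h2; apply/andP; split; lra.
Qed.

End LineTranslation.

Section TorusTranslation.
Local Open Scope classical_set_scope.
Local Open Scope ereal_scope.
Variable R : realType.
Local Notation RT := (measurableTypeR R).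

Definition tuple_shift d (v : 'I_d -> R) (t : d.-tuple RT) : d.-tuple RT :=
  [tuple (tnth t i + v i)%R | i < d].

Lemma measurable_tuple_shift d (v : 'I_d -> R) : measurable_fun setT (tuple_shift v).
Proof.
apply/measurable_fun_tnthP => i.
rewrite (_ : _ \o _ = line_shift (v i) \o (fun t => tnth t i)).
  by apply: measurableT_comp; [exact: measurable_line_shift|exact: measurable_tnth].
by apply/funext => t /=; rewrite tnth_mktuple.
Qed.

Definition tuple_periodic d (T : Type) (f : d.-tuple RT -> T) :=
  forall (z : 'I_d -> int) t, f (tuple_shift (fun i => (z i)%:~R) t) = f t.

Lemma ge0_integral_uniform_periodic_shift (a : R) (f : R -> \bar R) :
  measurable_fun setT f -> (forall x, 0 <= f x) -> (forall x, f (x + 1)%R = f x) ->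
  \int[uniform_prob (@ltr01 R)]_x f (x + a)%R = \int[uniform_prob (@ltr01 R)]_x f x.
Proof.
move=> mf f0 fp; rewrite !integral_uniform //; last first.
  by apply: (measurableT_comp mf); exact: measurable_line_shift.
by rewrite ge0_integral_periodic_shift.
Qed.

Lemma ge0_torus_integralS d (f : d.+1.-tuple RT -> \bar R) :
  measurable_fun setT f -> (forall t, 0 <= f t) ->
  \int[torus_measure R d.+1]_t f t =
  \int[uniform_prob (@ltr01 R)]_x \int[torus_measure R d]_t f [tuple of x :: t].
Proof.
move=> mf f0; rewrite /torus_measure /=.
rewrite ge0_integral_pushforward //.
rewrite fubini_tonelli1 // => [|x /=]; last exact: f0.
by apply: measurableT_comp => //; exact: measurable_cons.
Qed.

Lemma measurable_torus_integral d (f : d.+1.-tuple RT -> \bar R) :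
  measurable_fun setT f -> (forall t, 0 <= f t) ->
  measurable_fun setT (fun x : RT => \int[torus_measure R d]_t f [tuple of x :: t]).
Proof.
move=> mf f0.
pose g (p : RT * d.-tuple RT) := f [tuple of p.1 :: p.2].
have mg : measurable_fun setT g.
  by apply: (measurableT_comp mf); exact: measurable_cons.
by apply: (@measurable_fun_fubini_tonelli_F _ _ _ _ _ (torus_measure R d) g) => // x; exact: f0.
Qed.

Lemma tuple_shift_cons d (v : 'I_d.+1 -> R) (x : RT) (t : d.-tuple RT) :
  tuple_shift v [tuple of x :: t] =
  [tuple of (x + v ord0)%R :: tuple_shift (fun i => v (lift ord0 i)) t].
Proof.
apply: eq_from_tnth => i; rewrite tnth_mktuple.
case: (unliftP ord0 i) => [j|] ->; first by rewrite !tnthS tnth_mktuple.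
by rewrite !tnth0.
Qed.

(** Working with nonnegative functions lets Tonelli's theorem carry the induction
on the dimension without any integrability condition. *)
Lemma ge0_torus_integral_shift d (v : 'I_d -> R) (f : d.-tuple RT -> \bar R) :
  measurable_fun setT f -> (forall t, 0 <= f t) -> tuple_periodic f ->
  \int[torus_measure R d]_t f (tuple_shift v t) = \int[torus_measure R d]_t f t.
Proof.
elim: d v f => [|d IH] v f mf f0 fp.
  by congr (integral _ _ _); apply/funext => t; congr f; apply: eq_from_tnth; case.
rewrite !ge0_torus_integralS //; last first.
  by apply: (measurableT_comp mf); exact: measurable_tuple_shift.
pose F x := \int[torus_measure R d]_t f [tuple of x :: t].
have mcons (x : RT) : measurable_fun setT (fun t : d.-tuple RT => f [tuple of x :: t]).
  by apply: (measurableT_comp mf); apply: measurable_cons.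
transitivity (\int[uniform_prob (@ltr01 R)]_x F (x + v ord0)%R).
  apply: eq_integral => x _.
  under eq_integral => t _ do rewrite tuple_shift_cons.
  rewrite (IH (fun i => v (lift ord0 i)) (fun t => f [tuple of (x + v ord0)%R :: t])) //.
  move=> z t.
  pose z' (i : 'I_d.+1) := if unlift ord0 i is Some j then z j else 0%R.
  rewrite -[RHS](fp z') tuple_shift_cons /z' unlift_none addr0.
  rewrite [in RHS](_ : (fun i => _) = (fun i => (z i)%:~R)) //.
  by apply/funext => j; rewrite liftK.
apply: ge0_integral_uniform_periodic_shift.
- exact: measurable_torus_integral.
- by move=> x; apply: integral_ge0.
move=> x; rewrite /F; apply: eq_integral => t _.
pose z (i : 'I_d.+1) : int := if i == ord0 then 1%R else 0%R.
rewrite -[RHS](fp z [tuple of x :: t]) tuple_shift_cons /=.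
congr (f _); apply: eq_from_tnth => i.
case: (unliftP ord0 i) => [j|] ->; last by rewrite !tnth0.
by rewrite !tnthS tnth_mktuple addr0.
Qed.

Lemma measurable_tuple_box d (e : R) :
  measurable [set t : d.-tuple RT | forall i, (0 <= tnth t i <= e)%R].
Proof.
rewrite (_ : mkset _ = \big[setI/setT]_(i < d) ((fun t => tnth t i) @^-1` `[0%R, e])).
  apply: bigsetI_measurable => i _; rewrite -[X in measurable X]setTI.
  exact: measurable_tnth.
apply/seteqP; split=> t.
  by move=> h; rewrite -bigcap_seq => i _ /=; rewrite in_itv /= h.
by rewrite -bigcap_seq => h i; have := h i (mem_index_enum i); rewrite /= in_itv.
Qed.

Lemma torus_measure_box_gt0 d (e : R) : (0 < e)%R ->
  0 < torus_measure R d [set t | forall i, (0 <= tnth t i <= e)%R].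
Proof.
move=> e0; elim: d => [|d IH].
  by rewrite /torus_measure /= diracE mem_set ?lte01 // => -[].
rewrite /torus_measure /= /pushforward.
rewrite (_ : _ @^-1` _ =
    `[0%R, e] `*` [set t : d.-tuple RT | forall i, (0 <= tnth t i <= e)%R]); last first.
  apply/seteqP; split=> [[x t] /= h|[x t] [/= xe h] i].
    split; first by rewrite /= in_itv /=; have := h ord0; rewrite tnth0.
    by move=> i; have := h (lift ord0 i); rewrite tnthS.
  case: (unliftP ord0 i) => [j|] ->; first by rewrite tnthS.
  by move: xe; rewrite tnth0 in_itv.
have mbox := @measurable_tuple_box d e.
rewrite product_measure1E // mule_gt0 //.
change (0 < \int[lebesgue_measure]_(x in `[0%R, e]) (uniform_pdf 0 1 x)%:E).
rewrite integral_uniform_pdf.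
rewrite (eq_integral (fun=> 1)); last first.
  move=> x; rewrite inE => -[_]; rewrite /= in_itv /= /uniform_pdf => ->.
  by rewrite subr0 invr1.
have -> : `[0%R, e] `&` `[0%R, 1%R] = `[0%R, (Num.min e 1)%R] :> set R.
  apply/seteqP; split=> x; rewrite /= !in_itv /= le_min.
    by case=> /andP[-> ->] /andP[_ ->].
  by case/and3P=> -> -> ->.
rewrite integral_cst //= mul1e lebesgue_measure_itv /= lte_fin lt_min e0 ltr01.
by rewrite oppr0 adde0 lte_fin lt_min e0 ltr01.
Qed.

End TorusTranslation.

(** * Increments of an everywhere differentiable function *)

Section Increments.
Local Open Scope classical_set_scope.
Variable R : realType.
Local Notation mu := (@lebesgue_measure R).

(** A relation between endpoints that holds for short intervals around each point
and survives concatenation holds globally; this is compactness of [a, b] in the form of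
real induction. *)
Lemma interval_chain (Q : R -> R -> Prop) (a b : R) : a <= b ->
  (forall u v w, u <= v <= w -> Q u v -> Q v w -> Q u w) ->
  (forall s, a <= s <= b -> exists2 e, 0 < e &
     forall u v, a <= u <= s -> s <= v <= b -> s - e < u -> v < s + e -> Q u v) ->
  Q a b.
Proof.
move=> ab Qtrans Qloc.
pose S := [set x | a <= x <= b /\ Q a x].
have Sa : S a.
  split; first by rewrite lexx.
  have [|e e0] := Qloc a; first by rewrite lexx.
  apply; rewrite ?lexx ?ab //; lra.
have supS : has_sup S.
  by split; [exists a|exists b => x [/andP[]]].
set s := sup S.
have as_ : a <= s by apply: ub_le_sup; [case: supS|].
have sb : s <= b by apply: ge_sup; [exists a|move=> x [/andP[]]].
have [|e e0 Qe] := Qloc s; first by rewrite as_.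
have [x [/andP[ax xb] Qax] xs] := sup_adherent e0 supS.
rewrite -/s in xs.
have xles : x <= s by apply: ub_le_sup; [case: supS|split=> //; rewrite ax].
have reach v : s <= v -> v <= b -> v < s + e -> Q a v.
  move=> sv vb ve; apply: (Qtrans a x v) => //; first by rewrite ax (le_trans xles).
  by apply: Qe; rewrite ?ax ?sv.
have [sb'|sb'] := ltP s b; last by apply: reach; lra.
have : Num.min b (s + e / 2) <= s.
  have h1 : s <= Num.min b (s + e / 2) by rewrite le_min; apply/andP; split; lra.
  have h2 : Num.min b (s + e / 2) <= b by rewrite ge_min lexx.
  have h3 : Num.min b (s + e / 2) <= s + e / 2 by rewrite ge_min lexx orbT.
  apply: ub_le_sup; first by case: supS.
  split; first by apply/andP; split; lra.
  by apply: reach => //; lra.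
rewrite ge_min; case/orP; lra.
Qed.

Lemma measure_itv_incr (G : set R) (a u v : R) : open G -> a <= u <= v ->
  (mu G < +oo)%E ->
  `[u, v] `<=` G ->
  v - u <= fine (mu (G `&` `]a, v])) - fine (mu (G `&` `]a, u])).
Proof.
move=> oG /andP[au uv] Gfin uvG.
have mG := open_measurable oG.
have fin x : mu (G `&` `]a, x]) \is a fin_num.
  rewrite ge0_fin_numE //; apply: le_lt_trans Gfin.
  by apply: le_measure; rewrite ?inE //; exact: measurableI.
have e : G `&` `]a, v] = (G `&` `]a, u]) `|` `]u, v].
  apply/seteqP; split=> [x [Gx]|x [[Gx]|]]; rewrite /= !in_itv /=.
  - move=> /andP[ax xv]; have [xu|ux] := lerP x u.
      by left; split=> //; apply/andP.
    by right; apply/andP.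
  - by move=> /andP[ax xu]; split=> //; apply/andP; split=> //; lra.
  - move=> /andP[ux xv]; split; last by apply/andP; split; lra.
    by apply: uvG; rewrite /= in_itv /=; apply/andP; split; lra.
have d : [disjoint G `&` `]a, u] & `]u, v]].
  by apply/disj_setPS => x [[_]] /=; rewrite !in_itv /= => /andP[_ h1] /andP[h2 _]; lra.
rewrite e measureU //; last 2 first.
- exact: measurableI.
- exact/disj_set2P.
have muv : mu `]u, v] = (v - u)%:E.
  rewrite lebesgue_measure_itv /= lte_fin; case: ltP => h; first by rewrite -EFinB.
  by congr (_%:E); lra.
have -> : fine (mu (G `&` `]a, u]) + mu `]u, v]) = fine (mu (G `&` `]a, u])) + (v - u).
  by rewrite muv fineD.
by rewrite addrAC subrr add0r.
Qed.

Lemma is_derive_increment_near (g : R -> R) (l s e : R) :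
  is_derive s (1 : R) g l -> 0 < e ->
  exists2 delta, 0 < delta & forall x, `|x - s| < delta ->
    `|g x - g s - l * (x - s)| <= e * `|x - s|.
Proof.
move=> [dg lE] e0.
have : h^-1 *: (g (h + s) - g s) @[h --> 0^'] --> l.
  by rewrite -lE; move: dg; rewrite /derivable /derive /=; under eq_fun do rewrite [_ *: 1]mulr1.
move=> /cvgrPdist_le /(_ e e0).
rewrite near_withinE => /nbhs_ballP [delta /= d0 H].
exists delta => // x xs.
have [->|xns] := eqVneq x s; first by rewrite !subrr mulr0 subrr normr0 mulr0.
have xs0 : x - s != 0 by rewrite subr_eq0.
have := H (x - s); rewrite /ball /= sub0r normrN => /(_ xs xs0).
rewrite subrK => h.
have -> : g x - g s - l * (x - s) = - ((l - (x - s)^-1 *: (g x - g s)) * (x - s)).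
  by rewrite /GRing.scale /=; field.
by rewrite normrN normrM ler_wpM2r.
Qed.

(** For an absolutely continuous g this would be the fundamental theorem of calculus, but here
the derivative may be unbounded on the null set N.  Cover N by open sets G_n
so small that the sum of (n+1) mu(G_n) is negligible; around a point of N where
g' <= L + n + 1, the excess increment over a short interval inside G_n is paid
for by (n+1) times the measure of that interval. *)
Lemma increment_le_ae (g g' : R -> R) (N : set R) (L a b : R) : a <= b ->
  (forall x, is_derive x (1 : R) g (g' x)) ->
  measurable N -> mu N = 0%E -> (forall x, ~ N x -> g' x <= L) ->
  g b - g a <= L * (b - a).
Proof.
move=> ab dg mN N0 g'L; apply/ler_addgt0Pr => eps eps0.
(* The excess is at most e (b - a) from differentiability and e from the sets G_n. *)
pose e := eps / (b - a + 2).
have e0 : 0 < e by rewrite divr_gt0 // ; lra.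
pose eta n : R := e / (2 ^+ n.+1 * n.+1%:R).
have eta0 n : 0 < eta n by rewrite divr_gt0 // mulr_gt0 // exprn_gt0.
have /choice [G GP] n : exists G : set R, [/\ open G, N `<=` G & (mu G < (eta n)%:E)%E].
  have [||U [oU NU mU]] := @lebesgue_regularity_outer R N (eta n) mN.
  - by rewrite -[X in (X < _)%E]/(mu N) N0.
  - exact: eta0.
  exists U; split => //; apply: le_lt_trans mU.
  have mUN : measurable (U `\` N) by apply: measurableD => //; exact: open_measurable.
  rewrite -[X in (mu X <= _)%E](setDUK NU).
  apply: le_trans (measureU2 lebesgue_measure mN mUN) _.
  by rewrite -[X in (X + _ <= _)%E]/(mu N) N0 add0e.
have Gfin n : (mu (G n) < +oo)%E by have [_ _ h] := GP n; apply: lt_trans h (ltry _).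
pose p n x := fine (mu (G n `&` `]a, x])).
have mGi n x : measurable (G n `&` `]a, x]).
  by apply: measurableI => //; apply: open_measurable; case: (GP n).
have pfin n x : mu (G n `&` `]a, x]) \is a fin_num.
  rewrite ge0_fin_numE //; apply: le_lt_trans (Gfin n).
  by apply: le_measure; rewrite ?inE //; [exact: mGi|apply: open_measurable; case: (GP n)].
have pmono n u v : u <= v -> p n u <= p n v.
  move=> uv; apply: fine_le => //; apply: le_measure; rewrite ?inE; try exact: mGi.
  apply: setIS => x; rewrite /= !in_itv /= => /andP[-> xu]; lra.
have p_le n : p n b <= eta n.
  rewrite -lee_fin fineK //; have [oG _ /ltW] := GP n; apply: le_trans.
  by apply: le_measure; rewrite ?inE //; [exact: mGi|exact: open_measurable].
(* The sum over n is cut at K' to avoid series; the cut that an interval needs depends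
   on it, hence the quantifiers. *)
pose Q u v := exists K, forall K', (K <= K')%N ->
  g v - g u <= (L + e) * (v - u) + \sum_(n < K') n.+1%:R * (p n v - p n u).
suff : Q a b.
  move=> [K /(_ K (leqnn K)) H]; apply: le_trans H _.
  have h : \sum_(n < K) n.+1%:R * (p n b - p n a) <= e * (1 - (2 ^+ K)^-1).
    elim: K => [|K IH]; first by rewrite big_ord0 expr0 invr1 subrr mulr0.
    rewrite big_ord_recr /=.
    have pa : p K a = 0 by rewrite /p set_itv_ge ?bnd_simp // setI0 measure0.
    have : K.+1%:R * (p K b - p K a) <= e / 2 ^+ K.+1.
      rewrite pa subr0; apply: le_trans (ler_wpM2l _ (p_le K)) _ => //.
      rewrite /eta le_eqVlt; apply/orP; left; apply/eqP; field.
      by rewrite expf_neq0 //= pnatr_eq0.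
    have -> : e * (1 - (2 ^+ K.+1)^-1) = e * (1 - (2 ^+ K)^-1) + e / 2 ^+ K.+1 :> R.
      by rewrite exprS; field; rewrite expf_neq0.
    by move=> h; apply: lerD.
  have h2 : 0 <= e / 2 ^+ K by rewrite divr_ge0 ?exprn_ge0 // ltW.
  have h3 : e * (b - a + 2) = eps by rewrite /e divfK //; apply/eqP; lra.
  nra.
apply: interval_chain => //.
  move=> u v w _ [K1 H1] [K2 H2]; exists (maxn K1 K2) => K'; rewrite geq_max => /andP[k1 k2].
  have := lerD (H1 _ k1) (H2 _ k2).
  have -> : \sum_(n < K') n.+1%:R * (p n w - p n u) =
     \sum_(n < K') n.+1%:R * (p n v - p n u) + \sum_(n < K') n.+1%:R * (p n w - p n v).
    by rewrite -big_split; apply: eq_bigr => n _ /=; ring.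
  lra.
move=> s asb.
have [d1 d10 D1] := is_derive_increment_near (dg s) e0.
have gest u v : u <= s -> s <= v -> s - d1 < u -> v < s + d1 ->
    g v - g u <= (g' s + e) * (v - u).
  move=> us sv ud vd.
  have := D1 u; have := D1 v; rewrite !ler_norml !ltr_norml.
  rewrite ger0_norm ?subr_ge0 // ler0_norm ?subr_le0 //.
  move=> h1 h2.
  have /andP[_ h1'] : - (e * (v - s)) <= g v - g s - g' s * (v - s) <= e * (v - s).
    by apply: h1; apply/andP; split; lra.
  have /andP[h2' _] : - (e * - (u - s)) <= g u - g s - g' s * (u - s) <= e * - (u - s).
    by apply: h2; apply/andP; split; lra.
  lra.
have [Ns|/g'L gsL] := pselect (N s); last first.
  exists d1 => // u v /andP[au us] /andP[sv vb] ud vd; exists 0%N => K' _.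
  apply: le_trans (gest _ _ us sv ud vd) _; apply: ler_wpDr.
    by apply: sumr_ge0 => n _; rewrite mulr_ge0 // subr_ge0 pmono //; lra.
  apply: ler_wpM2r; lra.
pose n := Num.truncn `|g' s - L|.
have gn : g' s - L <= n.+1%:R.
  apply: le_trans (ler_norm _) _; apply/ltW.
  by case/andP: (Num.Theory.truncn_itv (normr_ge0 (g' s - L))).
have [oG NG _] := GP n.
have /nbhs_ballP [d2 /= d20 D2] : nbhs s (G n) by apply: open_nbhs_nbhs; split => //; exact: NG.
exists (Num.min d1 d2); first by rewrite lt_min d10.
move=> u v /andP[au us] /andP[sv vb] ud vd.
have h1 : Num.min d1 d2 <= d1 by rewrite ge_min lexx.
have h2 : Num.min d1 d2 <= d2 by rewrite ge_min lexx orbT.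
exists n.+1 => K' nK'.
apply: le_trans (gest u v us sv _ _) _; [lra|lra|].
rewrite (bigD1 (Ordinal nK')) //=.
have h3 : v - u <= p n v - p n u.
  apply: measure_itv_incr => //; first by rewrite au (le_trans us).
  move=> x; rewrite /= in_itv /= => /andP[ux xv]; apply: D2.
  rewrite /ball /= ltr_norml; apply/andP; split; lra.
have h4 : 0 <= \sum_(i < K' | i != Ordinal nK') i.+1%:R * (p i v - p i u).
  by apply: sumr_ge0 => i _; rewrite mulr_ge0 // subr_ge0 pmono //; lra.
have h5 : (g' s - L) * (v - u) <= n.+1%:R * (p n v - p n u).
  apply: le_trans (ler_wpM2r _ gn) _; first lra.
  by rewrite ler_wpM2l.
lra.
Qed.

End Increments.

(** * Functions on the torus *)

Section TorusFunctions.
Local Open Scope classical_set_scope.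
Variables (R : realType) (d : nat).
Local Notation RT := (measurableTypeR R).
Local Notation rv := (@rv_of_tuple R d).

Lemma rv_of_tuple_shift (v : 'I_d -> R) (t : d.-tuple RT) :
  rv (tuple_shift v t) = rv t + \row_i v i.
Proof. by apply/rowP => i; rewrite !mxE tnth_mktuple. Qed.

Lemma measurable_countable_valued (T : countType) d' (T' : measurableType d')
    (z : T' -> T) (g : T -> R) :
  (forall a, measurable (z @^-1` [set a])) -> measurable_fun setT (g \o z).
Proof.
move=> mz _ Y mY; rewrite setTI.
have -> : (g \o z) @^-1` Y =
    \bigcup_a (if a \in g @^-1` Y then z @^-1` [set a] else set0).
  rewrite -bigcup_mkcond; apply/seteqP; split=> [x Yx|x [a /= Ya za]].
    by exists (z x).
  by move: Ya; rewrite -za.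
by apply: countable_bigcupT_measurable => // a; case: ifP.
Qed.

Lemma mx_norm_le (x : 'rV[R]_d) (e : R) : 0 <= e ->
  (forall i, `|x 0 i| <= e) -> `|x| <= e.
Proof.
move=> e0 xe; rewrite /Num.norm /= mx_normrE; apply: bigmax_le => // -[i j] _ /=.
by rewrite ord1.
Qed.

(** Row vectors carry a topology and tuples a product sigma-algebra.  A continuous
f is the pointwise limit of its values at the lattice points of mesh 1/(n+1),
and these depend on countably many measurable cells. *)
Lemma measurable_rv_continuous (f : 'rV[R]_d -> R) :
  continuous f -> measurable_fun setT (f \o rv).
Proof.
move=> cf.
pose z n (t : d.-tuple RT) : 'rV[int]_d := \row_i Num.floor (n.+1%:R * tnth t i).
pose h n (t : d.-tuple RT) := f (\row_i ((z n t 0 i)%:~R / n.+1%:R)).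
have zP n t i : (z n t 0 i)%:~R <= n.+1%:R * tnth t i < (z n t 0 i)%:~R + 1.
  by have := Num.Theory.floor_itv (n.+1%:R * tnth t i); rewrite intrD mxE.
apply: (@measurable_fun_cvg _ _ _ _ h) => //.
  move=> n.
  apply: (@measurable_countable_valued _ _ _ (z n)
    (fun a : 'rV[int]_d => f (\row_i ((a 0 i)%:~R / n.+1%:R)))) => a.
  have -> : z n @^-1` [set a] =
    \big[setI/setT]_(i < d) ((fun t => tnth t i) @^-1`
       `[(a 0 i)%:~R / n.+1%:R, ((a 0 i)%:~R + 1) / n.+1%:R[).
    rewrite -bigcap_seq; apply/seteqP; split=> [t <- i _|t H].
      by rewrite /= in_itv /= ler_pdivrMr // ltr_pdivlMr // [tnth t i * _]mulrC zP.
    apply/rowP => i; rewrite mxE; apply: floor_def.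
    have := H i (mem_index_enum i).
    by rewrite /= in_itv /= ler_pdivrMr // ltr_pdivlMr // [tnth t i * _]mulrC intrD.
  apply: bigsetI_measurable => i _; rewrite -[X in measurable X]setTI.
  exact: measurable_tnth.
move=> t _ /=; apply: continuous_cvg; first exact: cf.
apply/cvgrPdist_le => /= e e0; near=> n.
apply: mx_norm_le; first exact: ltW.
move=> i; rewrite !mxE.
have n0 : 0 < n.+1%:R :> R by [].
have ne : 1 <= e * n.+1%:R.
  rewrite -ler_pdivrMl // mulr1.
  near: n; exists (Num.truncn e^-1) => // m /= em.
  have e1 : 0 <= e^-1 by rewrite invr_ge0 ltW.
  case/andP: (Num.Theory.truncn_itv e1) => _ /ltW /le_trans; apply.
  by rewrite ler_nat ltnS.
rewrite -(ler_pM2r n0) -[X in _ * X <= _](ger0_norm (ltW n0)) -normrM mulrBl divfK ?gt_eqF //.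
have := zP n t i; rewrite mxE mulrC => /andP[h1 h2].
rewrite ler_norml; apply/andP; split; lra.
Unshelve. all: end_near.
Qed.

End TorusFunctions.

Section DifferenceQuotients.
Local Open Scope classical_set_scope.

Lemma derive_seq_cvg (R : realType) (V : normedModType R) (f : V -> R) (x v : V) :
  derivable f x v ->
  (fun n : nat => n.+1%:R * (f (x + n.+1%:R^-1 *: v) - f x)) @ \oo --> 'D_v f x.
Proof.
move=> df.
apply/cvgrPdist_le => e e0.
have /cvgrPdist_le /(_ e e0) := df.
rewrite near_withinE => /nbhs_ballP [delta /= d0 H].
near=> n.
have h1 : ball (0 : R) delta n.+1%:R^-1.
  rewrite /ball /= sub0r normrN ger0_norm ?invr_ge0 //.
  by near: n; exact: (near_infty_natSinv_lt (PosNum d0)).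
have h2 : n.+1%:R^-1 != 0 :> R by rewrite invr_eq0.
by have := H _ h1 h2; rewrite invrK [_ *: v + x]addrC.
Unshelve. all: end_near.
Qed.

End DifferenceQuotients.

Section PartialDerivatives.
Local Open Scope classical_set_scope.
Variables (R : realType) (d : nat).
Local Notation RT := (measurableTypeR R).
Local Notation rv := (@rv_of_tuple R d).
Local Notation "''e_' i" := (delta_mx 0 i : 'rV[R]_d) (at level 8, i at level 2).

Lemma gradientE (f : 'rV[R]_d -> R) x i : gradient f x 0 i = 'D_('e_i) f x.
Proof. by rewrite mxE. Qed.

Lemma is_derive_line (f : 'rV[R]_d -> R) (x v : 'rV[R]_d) (s : R) :
  differentiable f (x + s *: v) ->
  is_derive s (1 : R) (fun s => f (x + s *: v)) ('D_v f (x + s *: v)).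
Proof.
move=> /(diff_derivable (v := v)).
have e : (fun h : R => h^-1 *: (((fun s => f (x + s *: v)) \o shift s) (h *: 1) - f (x + s *: v)))
   = (fun h : R => h^-1 *: ((f \o shift (x + s *: v)) (h *: v) - f (x + s *: v))).
  apply/funext => h /=; congr (_ *: (f _ - _)).
  by rewrite [h%:A]mulr1 scalerDl addrCA.
move=> df; split; first by move: df; rewrite /derivable e.
by rewrite /derive e.
Qed.

Lemma continuous_shift (f : 'rV[R]_d -> R) (w : 'rV[R]_d) :
  continuous f -> continuous (fun x : 'rV[R]_d => f (x + w)).
Proof.
move=> cf x; apply: (@continuous_comp _ _ _ (fun x : 'rV[R]_d => x + w) f); last exact: cf.
exact: (cvgD cvg_id (cvg_cst w)).
Qed.

Lemma measurable_partial (f : 'rV[R]_d -> R) (v : 'rV[R]_d) :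
  (forall x, differentiable f x) -> measurable_fun setT ('D_v f \o rv).
Proof.
move=> df.
have cf : continuous f by move=> x; apply: differentiable_continuous.
apply: (@measurable_fun_cvg _ _ _ _
  (fun n t => n.+1%:R * (f (rv t + n.+1%:R^-1 *: v) - f (rv t)))) => // [n|t _].
  apply: measurable_funM => //; apply: measurable_funB; last exact: measurable_rv_continuous.
  exact: (measurable_rv_continuous (@continuous_shift f (n.+1%:R^-1 *: v) cf)).
by apply: derive_seq_cvg; apply: diff_derivable.
Qed.

Lemma Zperiodic_derive (f : 'rV[R]_d -> R) (v : 'rV[R]_d) :
  Zperiodic f -> Zperiodic ('D_v f).
Proof.
move=> fp x z; rewrite /derive.
have e : (fun h : R => h^-1 *: ((f \o shift (x + map_mx intr z)) (h *: v) - f (x + map_mx intr z)))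
   = (fun h : R => h^-1 *: ((f \o shift x) (h *: v) - f x)).
  by apply/funext => h /=; rewrite addrA !fp.
by rewrite e.
Qed.

Lemma Zperiodic_tuple (T : Type) (f : 'rV[R]_d -> T) :
  (forall (x : 'rV[R]_d) (z : 'rV[int]_d), f (x + map_mx intr z) = f x) ->
  tuple_periodic (f \o rv).
Proof.
move=> fp z t; rewrite /= rv_of_tuple_shift -[RHS](fp _ (\row_i z i)).
by congr (f (_ + _)); apply/rowP => i; rewrite !mxE.
Qed.

Lemma tuple_shift_row (v : 'rV[R]_d) (t : d.-tuple RT) :
  rv (tuple_shift (v 0) t) = rv t + v.
Proof. by rewrite rv_of_tuple_shift; congr (_ + _); apply/rowP => i; rewrite mxE. Qed.

(** Translation invariance makes the preimage of B null for each fixed s, hence by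
Tonelli the line through almost every base point meets B in a null set; a box
of side e has positive measure and so contains such a base point. *)
Lemma generic_line_avoids_null_set (B : set 'rV[R]_d) (x v : 'rV[R]_d) (e : R) :
  measurable (rv @^-1` B) ->
  (forall (y : 'rV[R]_d) (z : 'rV[int]_d), B (y + map_mx intr z) <-> B y) ->
  torus_measure R d (rv @^-1` B) = 0%E -> 0 < e ->
  exists2 y : 'rV[R]_d, (forall i, 0 <= y 0 i <= e) &
    measurable [set s : R | B (x + y + s *: v)] /\
    lebesgue_measure [set s : R | B (x + y + s *: v)] = 0%E.
Proof.
move=> mB pB B0 e0.
pose P := torus_measure R d.
pose sh (p : d.-tuple RT * RT) := tuple_shift ((x + p.2 *: v) 0) p.1.
have msh : measurable_fun setT sh.
  apply/measurable_fun_tnthP => i.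
  rewrite (_ : _ \o _ = (fun p => tnth p.1 i + (x 0 i + p.2 * v 0 i))); last first.
    by apply/funext => p /=; rewrite tnth_mktuple !mxE.
  apply: measurable_funD; first exact: (measurableT_comp (measurable_tnth i) measurable_fst).
  by apply: measurable_funD => //; apply: measurable_funM.
pose A := sh @^-1` (rv @^-1` B).
have mA : measurable A by rewrite -[A]setTI; apply: msh.
pose F (p : d.-tuple RT * RT) := (\1_A p : R)%:E.
have mF : measurable_fun setT F by apply/measurable_EFinP; exact: measurable_indic.
have F0 p : (0 <= F p)%E by rewrite lee_fin.
have P0 s : (\int[P]_t F (t, s) = 0)%E.
  transitivity (\int[P]_t ((\1_(rv @^-1` B) (tuple_shift ((x + s *: v) 0) t) : R)%:E))%E.
    by apply: eq_integral => t _; rewrite /F !indicE.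
  rewrite (ge0_torus_integral_shift _ (f := fun t => (\1_(rv @^-1` B) t : R)%:E)) //.
  - by rewrite integral_indic // setIT.
  - by apply/measurable_EFinP; exact: measurable_indic.
  - apply: (Zperiodic_tuple (f := fun y => (\1_B y : R)%:E)) => y z.
    rewrite !indicE (_ : (_ \in B) = (y \in B)) //.
    by apply/idP/idP; rewrite !inE => /pB.
have intA0 : (\int[P]_t (\int[lebesgue_measure]_s F (t, s)) = 0)%E.
  have := @fubini_tonelli _ _ _ _ _ P (@lebesgue_measure R) F mF F0.
  rewrite /fubini_F /fubini_G => ->.
  by under eq_integral => s _ do rewrite P0; rewrite integral0.
have mI : measurable_fun setT (fun t => \int[lebesgue_measure]_s F (t, s))%E.
  exact: (@measurable_fun_fubini_tonelli_F _ _ _ _ _ (@lebesgue_measure R) F mF F0).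
have [Z [mZ Z0 HZ]] : ae_eq P setT (fun t => \int[lebesgue_measure]_s F (t, s))%E (cst 0%E).
  apply/(ae_eq_integral_abs _ measurableT mI).
  rewrite -[RHS]intA0; apply: eq_integral => t _; rewrite gee0_abs //.
  by apply: integral_ge0.
have [t tbox tZ] : exists2 t : d.-tuple RT, (forall i, 0 <= tnth t i <= e) & ~ Z t.
  apply: contrapT => noT.
  have := torus_measure_box_gt0 d e0; rewrite ltNge => /negP; apply.
  apply: le_trans (_ : (P Z <= 0)%E); last by rewrite Z0.
  apply: le_measure; rewrite ?inE //; first exact: measurable_tuple_box.
  by move=> t bt; apply: contrapT => nZ; apply: noT; exists t.
exists (rv t); first by move=> i; rewrite mxE.
have eN : [set s | B (x + rv t + s *: v)] = xsection A t.
  have e' s : rv (sh (t, s)) = x + rv t + s *: v.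
    by rewrite /sh tuple_shift_row /= addrA [rv t + x]addrC.
  by apply/seteqP; split=> s; rewrite /xsection /= inE /A /= e'.
rewrite eN; split; first exact: measurable_xsection.
have t0 : (\int[lebesgue_measure]_s F (t, s) = 0)%E.
  by apply: contrapT => h; apply: tZ; apply: HZ => /= /(_ Logic.I).
rewrite -[RHS]t0 -[LHS]/(lebesgue_measure (xsection A t)) -(setIT (xsection A t)).
rewrite -integral_indic //; last exact: measurable_xsection.
by apply: eq_integral => s _; rewrite /F !indicE mem_xsection.
Qed.

(** The bound for lines through generic points near x, from [increment_le_ae]
applied to f and to -f, passes to x by continuity. *)
Lemma partial_increment_le (f : 'rV[R]_d -> R) (v : 'rV[R]_d) (L : R) :
  Zperiodic f -> (forall x, differentiable f x) ->
  {ae torus_measure R d, forall t, `|'D_v f (rv t)| <= L} ->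
  forall x (h : R), 0 <= h -> `|f (x + h *: v) - f x| <= L * h.
Proof.
move=> fp df aeL x h h0.
have cf : continuous f by move=> y; apply: differentiable_continuous.
pose B := [set y : 'rV[R]_d | L < `|'D_v f y|].
have mD := measurable_partial v df.
have mB : measurable (rv @^-1` B).
  rewrite (_ : _ @^-1` _ = setT `&` ((fun r : R => `|r|) \o ('D_v f \o rv)) @^-1` `]L, +oo[).
    have mn : measurable_fun setT ((fun r : R => `|r|) \o ('D_v f \o rv)).
      exact: measurableT_comp.
    by apply: mn => //; exact: measurable_itv.
  by rewrite setTI; apply/seteqP; split=> t; rewrite /= /B /= in_itv /= andbT.
have B0 : torus_measure R d (rv @^-1` B) = 0%E.
  have [N [mN N0 HN]] := aeL.
  apply: (subset_measure0 mB mN) N0 => t Bt; apply: HN => /=.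
  by apply/negP; rewrite -ltNge.
have pB (y : 'rV[R]_d) (z : 'rV[int]_d) : B (y + map_mx intr z) <-> B y.
  by rewrite /B /= (Zperiodic_derive v fp).
have good e : 0 < e -> exists2 y : 'rV[R]_d, (forall i, 0 <= y 0 i <= e) &
    `|f (x + y + h *: v) - f (x + y)| <= L * h.
  move=> e0; have [y ye [mN N0]] := generic_line_avoids_null_set x v mB pB B0 e0.
  exists y => //.
  pose g s := f (x + y + s *: v).
  have dg s : is_derive s (1 : R) g ('D_v f (x + y + s *: v)) by exact: is_derive_line.
  have notN s : ~ [set s : R | B (x + y + s *: v)] s -> `|'D_v f (x + y + s *: v)| <= L.
    by rewrite /= /B /= leNgt => /negP.
  have H1 : g h - g 0 <= L * (h - 0).
    apply: (increment_le_ae h0 dg mN N0) => s /notN; exact: le_trans (ler_norm _).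
  have H2 : - g h - - g 0 <= L * (h - 0).
    apply: (increment_le_ae h0 (g := fun s => - g s)
      (g' := fun s => - 'D_v f (x + y + s *: v)) _ mN N0).
    by move=> s /notN; apply: le_trans; rewrite -normrN ler_norm.
  rewrite subr0 in H1 H2.
  have g0 : g 0 = f (x + y) by rewrite /g scale0r addr0.
  rewrite -/(g h) -g0 ler_norml; apply/andP; split; lra.
rewrite leNgt; apply/negP => bad.
pose D (y : 'rV[R]_d) : R := `|f (y + h *: v) - f y| - L * h.
have cD : continuous D.
  have c1 := @continuous_shift f (h *: v) cf.
  by move=> y; exact: (cvgB (cvg_norm (cvgB (c1 y) (cf y))) (cvg_cst (L * h))).
have Dx : 0 < D x by rewrite /D subr_gt0.
have /cvgrPdist_lt /(_ _ Dx) /nbhs_ballP [e /= e0 He] := cD x.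
have [y ye] := good (e / 2) (divr_gt0 e0 (ltr0Sn R 1)).
have bxy : ball x e (x + y).
  rewrite mx_norm_ball /ball_ /= opprD addrA subrr sub0r normrN.
  apply: le_lt_trans (_ : e / 2 < e); last lra.
  apply: mx_norm_le => [|i]; first lra.
  by case/andP: (ye i) => y0 y1; rewrite ger0_norm.
have := He _ bxy; rewrite /= ltr_norml /D => /andP[_]; lra.
Qed.

End PartialDerivatives.

(** * Means and trigonometric functions *)

Section Mean.
Local Open Scope classical_set_scope.
Variables (R : realType) (d : nat).
Local Notation rv := (@rv_of_tuple R d).
Local Notation P := (torus_measure R d).
Implicit Types (g h : 'rV[R]_d -> R) (m : 'rV[int]_d).

(** A class of functions closed under the operations used below, whose members
are all integrable. *)
Definition bounded_measurable g :=
  measurable_fun setT (g \o rv) /\ exists B : R, forall x, `|g x| <= B.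

Definition mean g : R := \int[P]_t g (rv t).

Lemma bounded_measurable_cst (r : R) : bounded_measurable (fun=> r).
Proof. by split; [exact: measurable_cst|exists `|r|]. Qed.

Lemma bounded_measurableD g h : bounded_measurable g -> bounded_measurable h ->
  bounded_measurable (fun x => g x + h x).
Proof.
move=> [mg [B gB]] [mh [C hC]]; split; first exact: measurable_funD.
by exists (B + C) => x; rewrite (le_trans (ler_normD _ _)) // lerD.
Qed.

Lemma bounded_measurableM g h : bounded_measurable g -> bounded_measurable h ->
  bounded_measurable (fun x => g x * h x).
Proof.
move=> [mg [B gB]] [mh [C hC]]; split; first exact: measurable_funM.
by exists (B * C) => x; rewrite normrM ler_pM.
Qed.

Lemma bounded_measurableZ (r : R) g : bounded_measurable g ->
  bounded_measurable (fun x => r * g x).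
Proof. exact/bounded_measurableM/bounded_measurable_cst. Qed.

Lemma bounded_measurableB g h : bounded_measurable g -> bounded_measurable h ->
  bounded_measurable (fun x => g x - h x).
Proof.
move=> bg bh; have := bounded_measurableD bg (bounded_measurableZ (-1) bh).
by under eq_fun do rewrite mulN1r.
Qed.

Lemma bounded_measurable_sum (I : Type) (s : seq I) (Q : pred I) (F : I -> 'rV[R]_d -> R) :
  (forall i, bounded_measurable (F i)) ->
  bounded_measurable (fun x => \sum_(i <- s | Q i) F i x).
Proof.
move=> bF; elim: s => [|i s IH].
  by under eq_fun do rewrite big_nil; exact: bounded_measurable_cst.
under eq_fun do rewrite big_cons; case: (Q i) => //.
exact: bounded_measurableD.
Qed.

Lemma bounded_measurable_norm g : bounded_measurable g ->
  bounded_measurable (fun x => `|g x|).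
Proof.
move=> [mg [B gB]]; split; first exact: measurableT_comp.
by exists B => x; rewrite normr_id.
Qed.

Lemma bounded_measurable_integrable g : bounded_measurable g ->
  P.-integrable setT (EFin \o (fun t => g (rv t))).
Proof.
move=> [mg [B gB]]; apply: measurable_bounded_integrable => //.
  by rewrite (le_lt_trans (probability_le1 _ measurableT)) // ltry.
exists B; split; first exact: num_real.
by move=> y By t _ /=; rewrite (le_trans (gB _)) // ltW.
Qed.

Lemma mean_cst r : mean (fun=> r) = r.
Proof. by rewrite /mean Rintegral_cst // [X in fine X](@probability_setT _ _ _ P) mulr1. Qed.

Lemma meanD g h : bounded_measurable g -> bounded_measurable h ->
  mean (fun x => g x + h x) = mean g + mean h.
Proof. by move=> bg bh; rewrite /mean RintegralD //; exact: bounded_measurable_integrable. Qed.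

Lemma meanB g h : bounded_measurable g -> bounded_measurable h ->
  mean (fun x => g x - h x) = mean g - mean h.
Proof. by move=> bg bh; rewrite /mean RintegralB //; exact: bounded_measurable_integrable. Qed.

Lemma meanZ r g : bounded_measurable g -> mean (fun x => r * g x) = r * mean g.
Proof. by move=> bg; rewrite /mean RintegralZl //; exact: bounded_measurable_integrable. Qed.

Lemma mean_sum (I : Type) (s : seq I) (Q : pred I) (F : I -> 'rV[R]_d -> R) :
  (forall i, bounded_measurable (F i)) ->
  mean (fun x => \sum_(i <- s | Q i) F i x) = \sum_(i <- s | Q i) mean (F i).
Proof.
move=> bF; elim: s => [|i s IH].
  by under eq_fun do rewrite big_nil; rewrite mean_cst big_nil.
under eq_fun do rewrite big_cons; rewrite big_cons; case: (Q i) => //.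
by rewrite meanD ?IH //; exact: bounded_measurable_sum.
Qed.

Lemma mean_le g h : bounded_measurable g -> bounded_measurable h ->
  (forall x, g x <= h x) -> mean g <= mean h.
Proof.
by move=> bg bh gh; apply: le_Rintegral => //; exact: bounded_measurable_integrable.
Qed.

Lemma mean_norm g : bounded_measurable g -> `|mean g| <= mean (fun x => `|g x|).
Proof. by move=> bg; apply: le_normr_Rintegral => //; exact: bounded_measurable_integrable. Qed.

Lemma mean_norm_le g B : bounded_measurable g -> (forall x, `|g x| <= B) -> `|mean g| <= B.
Proof.
move=> bg gB; apply: le_trans (mean_norm bg) _; rewrite -[X in _ <= X]mean_cst.
by apply: mean_le => //; [exact: bounded_measurable_norm|exact: bounded_measurable_cst].
Qed.

(** The invariance is known for nonnegative functions; add an upper bound of |g|. *)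
Lemma mean_shift (v : 'rV[R]_d) g : bounded_measurable g -> Zperiodic g ->
  mean (fun x => g (x + v)) = mean g.
Proof.
move=> [mg [B gB]] gp.
have mgv : measurable_fun setT ((fun x => g (x + v)) \o rv).
  rewrite (_ : _ \o _ = (g \o rv) \o tuple_shift (v 0)); last first.
    by apply/funext => t /=; rewrite tuple_shift_row.
  by apply: measurableT_comp => //; exact: measurable_tuple_shift.
have bg : bounded_measurable g by split=> //; exists B.
have bgv : bounded_measurable (fun x => g (x + v)) by split=> //; exists B.
have bB := bounded_measurable_cst B.
apply: (addIr B); rewrite -[X in _ + X = _]mean_cst -[X in _ = _ + X]mean_cst -!meanD //.
rewrite /mean /Rintegral; congr fine.
rewrite (_ : (fun t => (g (rv t + v) + B)%:E) =
   (fun t => (g (rv (tuple_shift (v 0) t)) + B)%:E)); last first.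
  by apply/funext => t; rewrite tuple_shift_row.
apply: (@ge0_torus_integral_shift R d (v 0) (fun t => (g (rv t) + B)%:E)).
- by apply/measurable_EFinP; apply: measurable_funD.
- by move=> t; rewrite lee_fin; have := gB (rv t); rewrite ler_norml; lra.
- by apply: (Zperiodic_tuple (f := fun y => (g y + B)%:E)) => y z; rewrite gp.
Qed.

Lemma bounded_measurable_shift (v : 'rV[R]_d) g : bounded_measurable g ->
  bounded_measurable (fun x => g (x + v)).
Proof.
move=> [mg [B gB]]; split; last by exists B.
rewrite (_ : _ \o _ = (g \o rv) \o tuple_shift (v 0)); last first.
  by apply/funext => t /=; rewrite tuple_shift_row.
by apply: measurableT_comp => //; exact: measurable_tuple_shift.
Qed.

Lemma mean_cvg (g_ : nat -> 'rV[R]_d -> R) g (B : R) :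
  (forall n, measurable_fun setT (g_ n \o rv)) -> bounded_measurable g ->
  (forall n x, `|g_ n x| <= B) -> (forall x, g_ ^~ x @ \oo --> g x) ->
  mean \o g_ @ \oo --> mean g.
Proof.
move=> mg_ bg gB gg.
have [| | | | |_ _ H] := @dominated_convergence _ _ _ P setT measurableT
  (fun n t => (g_ n (rv t))%:E) (fun t => (g (rv t))%:E) (cst B%:E).
- by move=> n; apply/measurable_EFinP; exact: mg_.
- by apply/measurable_EFinP; exact: bg.1.
- by apply: aeW => t _; apply: cvg_EFin; [exact: nearW|exact: gg].
- exact: (bounded_measurable_integrable (bounded_measurable_cst B)).
- by apply: aeW => t n _; rewrite lee_fin.
apply: fine_cvg; rewrite /mean /Rintegral fineK //.
exact: (integrable_fin_num measurableT (bounded_measurable_integrable bg)).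
Qed.

(** The phase makes one family serve for cosines and sines, and for their
translates. *)
Definition cosine m (th : R) (x : 'rV[R]_d) : R := cos (2 * pi * mdot m x + th).

Lemma mdotD m (x y : 'rV[R]_d) : mdot m (x + y) = mdot m x + mdot m y.
Proof. by rewrite /mdot -big_split; apply: eq_bigr => j _; rewrite mxE mulrDr. Qed.

Lemma mdotDl m m' (x : 'rV[R]_d) : mdot (m + m') x = mdot m x + mdot m' x.
Proof. by rewrite /mdot -big_split; apply: eq_bigr => j _; rewrite mxE intrD mulrDl. Qed.

Lemma mdot_delta m (r : R) j : mdot m (r *: delta_mx 0 j) = (m 0 j)%:~R * r.
Proof.
rewrite /mdot (bigD1 j) //= !mxE !eqxx mulr1 big1 ?addr0 // => i ij.
by rewrite !mxE (negbTE ij) andbF !mulr0.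
Qed.

Lemma bounded_measurable_cosine m th : bounded_measurable (cosine m th).
Proof.
split; last by exists 1 => x; exact: cos_max.
apply: (measurableT_comp (f := fun r : R => cos r)).
  by apply: continuous_measurable_fun; exact: continuous_cos.
apply: measurable_funD => //; apply: measurable_funM => //.
rewrite (_ : (fun t => _) = (fun t => \sum_(j <- enum 'I_d) (m 0 j)%:~R * tnth t j)).
  by apply: measurable_sum => j; apply: measurable_funM => //; exact: measurable_tnth.
by apply/funext => t; rewrite /mdot big_enum; apply: eq_bigr => j _; rewrite mxE.
Qed.

Lemma cosD2piz (x : R) (z : int) : cos (x + 2 * pi * z%:~R) = cos x.
Proof.
have e : 2 * pi * z%:~R = (pi *+ 2) *~ z :> R by rewrite mulr_natl mulrzr.
have fn n y : cos (y + (pi *+ 2) *+ n) = cos y :> R by apply: periodicn; exact: cosD2pi.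
rewrite e; case: z {e} => n; first exact: fn.
by rewrite NegzE mulrNz -[in RHS](subrK ((pi *+ 2) *+ n.+1) x) fn.
Qed.

Lemma Zperiodic_cosine m th : Zperiodic (cosine m th).
Proof.
move=> x z; rewrite /cosine mdotD.
have -> : mdot m (map_mx intr z) = (\sum_j m 0 j * z 0 j)%:~R :> R.
  by rewrite rmorph_sum /mdot; apply: eq_bigr => j _; rewrite mxE /= intrM.
by rewrite mulrDr addrAC cosD2piz.
Qed.

(** Translating by half a period in a direction where m is nonzero changes the
sign. *)
Lemma mean_cosine m th : mean (cosine m th) = if m == 0 then cos th else 0.
Proof.
case: eqVneq => [->|m0].
  rewrite -[RHS]mean_cst; congr mean; apply/funext => x.
  by rewrite /cosine /mdot big1 ?mulr0 ?add0r // => j _; rewrite mxE mul0r.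
have [j mj] : exists j, m 0 j != 0.
  apply/existsP; apply: contraNT m0 => /existsPn h; apply/eqP/rowP => j.
  by rewrite mxE; apply/eqP; have := h j; rewrite negbK.
have mjR : (m 0 j)%:~R != 0 :> R by rewrite intr_eq0.
have := mean_shift ((2 * (m 0 j)%:~R)^-1 *: delta_mx 0 j)
  (bounded_measurable_cosine m th) (Zperiodic_cosine m th).
rewrite (_ : (fun x => _) = (fun x => -1 * cosine m th x)).
  by rewrite meanZ; [lra|exact: bounded_measurable_cosine].
apply/funext => x; rewrite /cosine mdotD mdot_delta mulN1r -cosDpi.
by congr cos; field.
Qed.

Lemma cosineM m th m' th' x : cosine m th x * cosine m' th' x =
  1 / 2 * (cosine (m - m') (th - th') x + cosine (m + m') (th + th') x).
Proof.
rewrite /cosine mdotB mdotDl.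
set a := 2 * pi * mdot m x + th; set b := 2 * pi * mdot m' x + th'.
have -> : 2 * pi * (mdot m x - mdot m' x) + (th - th') = a - b by rewrite /a /b; ring.
have -> : 2 * pi * (mdot m x + mdot m' x) + (th + th') = a + b by rewrite /a /b; ring.
by move: a b => a b; rewrite cosB cosD; field.
Qed.

Lemma mean_cosineM m th m' th' : mean (fun x => cosine m th x * cosine m' th' x) =
  1 / 2 * ((if m == m' then cos (th - th') else 0) +
           (if m == - m' then cos (th + th') else 0)).
Proof.
under eq_fun do rewrite cosineM.
rewrite meanZ; last by apply: bounded_measurableD; exact: bounded_measurable_cosine.
rewrite meanD; try exact: bounded_measurable_cosine.
by rewrite !mean_cosine subr_eq0 addr_eq0.
Qed.

End Mean.

(** * The Fejer-Korovkin kernel *)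

Section Kernel.
Variables (R : realType) (n : nat).

(** The top eigenvector of the adjacency matrix of a path with n+1 vertices: among
kernels |sum of a_p e(p x)|^2 with p = 1, ..., n+1 and unit mean it maximizes the
first Fourier coefficient, hence the concentration at 0. *)
Definition sine_weight (p : nat) : R := sin (pi * p%:R / n.+2%:R).

Definition sine_mass : R := \sum_(p < n.+1) sine_weight p.+1 ^+ 2.

Lemma sine_weight0 : sine_weight 0 = 0.
Proof. by rewrite /sine_weight mulr0 mul0r sin0. Qed.

Lemma sine_weight_end : sine_weight n.+2 = 0.
Proof. by rewrite /sine_weight mulfK ?pnatr_eq0 // sinpi. Qed.

Lemma sine_weight_rec p :
  sine_weight p + sine_weight p.+2 = 2 * cos (pi / n.+2%:R) * sine_weight p.+1.
Proof.
rewrite /sine_weight.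
set u := pi / n.+2%:R; set v := pi * p.+1%:R / n.+2%:R.
have -> : pi * p%:R / n.+2%:R = v - u by rewrite /u /v -natr1; ring.
have -> : pi * p.+2%:R / n.+2%:R = v + u by rewrite /u /v -[p.+2%:R]natr1; ring.
by move: u v => u v; rewrite sinB sinD; ring.
Qed.

Lemma sine_mass_gt0 : 0 < sine_mass.
Proof.
rewrite /sine_mass big_ord_recl /=; apply: ltr_wpDr.
  by apply: sumr_ge0 => i _; rewrite sqr_ge0.
rewrite exprn_gt0 // /sine_weight mulr1 sin_gt0_pi // divr_gt0 ?pi_gt0 //=.
by rewrite ltr_pdivrMr // ltr_pMr ?pi_gt0 // ltr1n.
Qed.

(** The coefficient of e(t x) in |sum of sine_weight p e(p x)|^2, normalized to
have mean 1. *)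
Definition korovkin_coeff (t : int) : R :=
  \sum_(p < n.+1) \sum_(q < n.+1)
    (sine_weight p.+1 * sine_weight q.+1 / sine_mass) *+ (p%:Z - q%:Z == t).

Lemma korovkin_coeff0 : korovkin_coeff 0 = 1.
Proof.
transitivity (sine_mass / sine_mass); last by rewrite mulfV // gt_eqF // sine_mass_gt0.
rewrite /korovkin_coeff {2}/sine_mass mulr_suml; apply: eq_bigr => p _.
rewrite (bigD1 p) //= subrr eqxx mulr1n -expr2 big1 ?addr0 // => q qp.
by rewrite subr_eq0 eqz_nat eq_sym (negbTE (qp : (q != p :> nat))) mulr0n.
Qed.

Lemma korovkin_coeffN t : korovkin_coeff (- t) = korovkin_coeff t.
Proof.
rewrite /korovkin_coeff exchange_big; apply: eq_bigr => p _; apply: eq_bigr => q _.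
by rewrite -opprB eqr_opp [sine_weight _ * _]mulrC.
Qed.

Lemma sum_at_most_one (I : finType) (F : I -> R) (S Q : pred I) (B : R) : 0 <= B ->
  (forall i j, Q i -> Q j -> i = j) -> (forall i, F i <= B) ->
  \sum_(i | S i) F i *+ Q i <= B.
Proof.
move=> B0 Q1 FB; case: (pickP (fun i => S i && Q i)) => [i /andP[Si Qi]|Q0]; last first.
  by rewrite big1 // => i Si; have := Q0 i; rewrite Si /= => ->.
rewrite (bigD1 i) //= Qi mulr1n big1 ?addr0 // => j /andP[_ ji].
by case Qj : (Q j); rewrite ?mulr0n //; rewrite (Q1 j i Qj Qi) eqxx in ji.
Qed.

Lemma korovkin_coeff_norm_le1 t : `|korovkin_coeff t| <= 1.
Proof.
have Z0 := sine_mass_gt0.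
(* Bound each product of two weights by half the sum of their squares; for a given t
   each p and each q occurs at most once. *)
pose b p := sine_weight p.+1 ^+ 2 / (2 * sine_mass).
have b0 p : 0 <= b p by rewrite divr_ge0 ?sqr_ge0 // mulr_ge0 // ltW.
have sb : \sum_(p < n.+1) b p = 1 / 2.
  rewrite /b -mulr_suml -/sine_mass; field; exact: lt0r_neq0.
apply: le_trans (_ : \sum_(p < n.+1) \sum_(q < n.+1) (b p + b q) *+ (p%:Z - q%:Z == t) <= _).
  apply: le_trans (ler_norm_sum _ _ _) _; apply: ler_sum => p _.
  apply: le_trans (ler_norm_sum _ _ _) _; apply: ler_sum => q _.
  rewrite normrMn lerMn2r; apply/orP; right.
  rewrite /b -mulrDl normrM [`|_^-1|]ger0_norm ?invr_ge0 ?(ltW Z0) //.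
  rewrite invfM mulrA ler_wpM2r ?invr_ge0 ?(ltW Z0) // ler_pdivlMr //.
  have := sqr_ge0 (sine_weight p.+1 - sine_weight q.+1).
  have := sqr_ge0 (sine_weight p.+1 + sine_weight q.+1).
  rewrite sqrrD sqrrB -mulr_natr.
  move: (sine_weight p.+1 * _) (sine_weight p.+1 ^+ 2) (sine_weight q.+1 ^+ 2) => z x y.
  by move=> h1 h2; case: (lerP 0 z) => hz; [rewrite ger0_norm|rewrite ltr0_norm] => //; lra.
have diff1 (p q q' : 'I_n.+1) : p%:Z - q%:Z == t -> p%:Z - q'%:Z == t -> q = q'.
  by move=> /eqP h1 /eqP h2; apply/val_inj => /=; lia.
have diff2 (p p' q : 'I_n.+1) : p%:Z - q%:Z == t -> p'%:Z - q%:Z == t -> p = p'.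
  by move=> /eqP h1 /eqP h2; apply/val_inj => /=; lia.
under eq_bigr => p _.
  under eq_bigr => q _ do rewrite mulrnDl.
  rewrite big_split /=; over.
rewrite big_split /= [X in _ + X <= _]exchange_big /=.
have -> : 1 = \sum_(p < n.+1) b p + \sum_(p < n.+1) b p :> R by rewrite sb; lra.
apply: lerD; apply: ler_sum => p _.
  by apply: sum_at_most_one => // q q'; apply: diff1.
by apply: (@sum_at_most_one _ (fun=> b p) xpredT) => // q q'; apply: diff2.
Qed.

(** Pairing each weight with its two neighbours, the recurrence of the weights
turns twice the first coefficient into 2 cos (pi/(n+2)) times the coefficient
at 0.  The index range may be extended by one on either side because the weights
vanish there. *)
Lemma korovkin_coeff1 : korovkin_coeff 1 = cos (pi / n.+2%:R).
Proof.
have Z0 := sine_mass_gt0.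
have pick_sum (F : nat -> R) (x : nat) : F n.+2 = 0 -> F 0%N = 0 -> (x <= n.+2)%N ->
    \sum_(p < n.+1) F p.+1 *+ (p.+1 == x) = F x.
  move=> Fn F0 xn; case: x xn => [|x] xn.
    by rewrite F0 big1 // => p _; rewrite mulr0n.
  have [xn'|xn'] := ltnP x n.+1.
    rewrite (bigD1 (Ordinal xn')) //= eqxx mulr1n big1 ?addr0 // => p px.
    by rewrite eqSS (negbTE (px : (p != x :> nat))) mulr0n.
  have -> : x = n.+1 by lia.
  by rewrite Fn big1 // => p _; have -> : (p.+1 == n.+2) = false by have := ltn_ord p; lia.
have up : korovkin_coeff 1 = \sum_(q < n.+1) sine_weight q.+1 * sine_weight q.+2 / sine_mass.
  rewrite /korovkin_coeff exchange_big; apply: eq_bigr => q _ /=.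
  rewrite -(pick_sum (fun x => sine_weight q.+1 * sine_weight x / sine_mass) q.+2) //=.
  - apply: eq_bigr => p _; rewrite [sine_weight p.+1 * _]mulrC; congr (_ *+ _).
    by apply/eqP/eqP; lia.
  - by rewrite sine_weight_end mulr0 mul0r.
  - by rewrite sine_weight0 mulr0 mul0r.
  - by have := ltn_ord q; lia.
have down : korovkin_coeff 1 = \sum_(p < n.+1) sine_weight p.+1 * sine_weight p / sine_mass.
  rewrite /korovkin_coeff; apply: eq_bigr => p _ /=.
  rewrite -(pick_sum (fun x => sine_weight p.+1 * sine_weight x / sine_mass) p) //=.
  - by apply: eq_bigr => q _; congr (_ *+ _); apply/eqP/eqP; lia.
  - by rewrite sine_weight_end mulr0 mul0r.
  - by rewrite sine_weight0 mulr0 mul0r.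
  - by have := ltn_ord p; lia.
have : korovkin_coeff 1 + korovkin_coeff 1 = 2 * cos (pi / n.+2%:R).
  rewrite {1}up down -big_split /=.
  transitivity (\sum_(p < n.+1) 2 * cos (pi / n.+2%:R) / sine_mass * sine_weight p.+1 ^+ 2).
    apply: eq_bigr => p _.
    rewrite -mulrDl -mulrDr [sine_weight p.+2 + _]addrC sine_weight_rec; ring.
  by rewrite -mulr_sumr -/sine_mass divfK // gt_eqF.
lra.
Qed.

Variable d : nat.
Implicit Types m : 'rV[int]_d.

(** Indexing the box of sup norm at most n by a finite type makes sums over it
finite; the shift by n centres it at 0. *)
Definition frequency (k : {ffun 'I_d -> 'I_(n.*2).+1}) : 'rV[int]_d :=
  \row_j ((k j)%:Z - n%:Z).

Lemma frequency_inj : injective frequency.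
Proof.
move=> k l /rowP e; apply/ffunP => j; apply/val_inj.
by have := e j; rewrite !mxE => /addIr [].
Qed.

Lemma frequency_norm k : (mnorm (frequency k) <= n)%N.
Proof.
apply/bigmax_leqP => j _; rewrite mxE.
have := ltn_ord (k j); lia.
Qed.

Lemma frequency_surj m : (mnorm m <= n)%N -> exists k, frequency k = m.
Proof.
move=> mn; exists [ffun j => inord (absz (m 0 j + n%:Z))].
apply/rowP => j; rewrite mxE ffunE.
have := mnorm_le m j; set a := m 0 j => h.
rewrite inordK; lia.
Qed.

Definition korovkin_weight (m : 'rV[int]_d) : R := \prod_j korovkin_coeff (m 0 j).

Definition korovkin_kernel (x : 'rV[R]_d) : R :=
  \sum_k korovkin_weight (frequency k) * cosine (frequency k) 0 x.

Lemma korovkin_weight_norm_le1 m : `|korovkin_weight m| <= 1.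
Proof.
rewrite normr_prod; apply: prodr_ile1 => j _.
by rewrite normr_ge0 korovkin_coeff_norm_le1.
Qed.

Lemma korovkin_weight0 : korovkin_weight 0 = 1.
Proof. by rewrite /korovkin_weight big1 // => j _; rewrite mxE korovkin_coeff0. Qed.

Lemma korovkin_weightN m : korovkin_weight (- m) = korovkin_weight m.
Proof. by apply: eq_bigr => j _; rewrite mxE korovkin_coeffN. Qed.

Lemma korovkin_weight_delta j : korovkin_weight (delta_mx 0 j) = cos (pi / n.+2%:R).
Proof.
rewrite /korovkin_weight (bigD1 j) //= mxE !eqxx korovkin_coeff1 big1 ?mulr1 // => i ij.
by rewrite mxE (negbTE ij) andbF korovkin_coeff0.
Qed.

(** A tensor product of squared moduli: the kernel is (C^2 + S^2) up to a positive
factor, C and S being the real and imaginary parts of the product of the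
one-variable sums. *)
Lemma korovkin_kernel_ge0 x : 0 <= korovkin_kernel x.
Proof.
pose K := {ffun 'I_d -> 'I_n.+1}.
pose A (k : K) : R := \prod_j sine_weight (k j).+1.
pose kap (k : K) : 'rV[int]_d := \row_j (k j)%:Z.
have wE m : korovkin_weight m =
    \sum_(k : K) \sum_(l : K) (A k * A l / sine_mass ^+ d) *+ (kap k - kap l == m).
  rewrite /korovkin_weight /korovkin_coeff bigA_distr_bigA; apply: eq_bigr => k _.
  rewrite bigA_distr_bigA; apply: eq_bigr => l _.
  have -> : (kap k - kap l == m) = [forall j, (k j)%:Z - (l j)%:Z == m 0 j].
    apply/eqP/forallP => [<- j|h]; first by rewrite !mxE.
    by apply/rowP => j; rewrite !mxE (eqP (h j)).
  case: forallP => [h|/forallP]; rewrite ?mulr1n ?mulr0n.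
    under eq_bigr => j _ do rewrite h mulr1n.
    rewrite !big_split /= prodfV; congr (_ * _^-1).
    by rewrite prodr_const card_ord.
  rewrite negb_forall => /existsP [j hj].
  by rewrite (bigD1 j) //= (negbTE hj) mulr0n mul0r.
have -> : korovkin_kernel x =
  \sum_(k : K) \sum_(l : K) A k * A l / sine_mass ^+ d * cosine (kap k - kap l) 0 x.
  rewrite /korovkin_kernel.
  under eq_bigr => i _.
    rewrite wE mulr_suml; under eq_bigr => k _ do rewrite mulr_suml; over.
  rewrite exchange_big /=; apply: eq_bigr => k _.
  rewrite exchange_big /=; apply: eq_bigr => l _.
  have [i ei] : exists i, frequency i = kap k - kap l.
    apply: frequency_surj; apply/bigmax_leqP => j _; rewrite !mxE.
    have := ltn_ord (k j); have := ltn_ord (l j); lia.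
  rewrite (bigD1 i) //= -ei eqxx mulr1n big1 ?addr0 // => i' i'i.
  by rewrite (inj_eq frequency_inj) eq_sym (negbTE i'i) mulr0n mul0r.
pose C := \sum_(k : K) A k * cos (2 * pi * mdot (kap k) x).
pose S := \sum_(k : K) A k * sin (2 * pi * mdot (kap k) x).
have -> : \sum_(k : K) \sum_(l : K) A k * A l / sine_mass ^+ d * cosine (kap k - kap l) 0 x
   = (C * C + S * S) / sine_mass ^+ d.
  rewrite /C /S !big_distrlr /= -big_split /= mulr_suml; apply: eq_bigr => k _.
  rewrite -big_split /= mulr_suml; apply: eq_bigr => l _.
  rewrite /cosine addr0 mdotB mulrBr cosB; ring.
by rewrite divr_ge0 ?addr_ge0 // -?expr2 ?sqr_ge0 // exprn_ge0 // ltW // sine_mass_gt0.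
Qed.

Lemma bounded_measurable_kernel : bounded_measurable korovkin_kernel.
Proof.
apply: bounded_measurable_sum => k.
exact/bounded_measurableZ/bounded_measurable_cosine.
Qed.

Lemma mean_kernelM m th : (mnorm m <= n)%N ->
  mean (fun x => korovkin_kernel x * cosine m th x) = korovkin_weight m * cos th.
Proof.
move=> mn; rewrite /korovkin_kernel.
under eq_fun do rewrite mulr_suml.
rewrite mean_sum; last first.
  move=> k; apply: bounded_measurableM; last exact: bounded_measurable_cosine.
  exact/bounded_measurableZ/bounded_measurable_cosine.
under eq_bigr => k _.
  under [in mean _]eq_fun do rewrite -mulrA.
  rewrite meanZ ?mean_cosineM; last first.
    apply: bounded_measurableM; exact: bounded_measurable_cosine.
  rewrite sub0r add0r cosN mulrCA mulrDr; over.
rewrite -mulr_sumr big_split /=.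
have pick m' : (mnorm m' <= n)%N -> \sum_k korovkin_weight (frequency k) *
    (if frequency k == m' then cos th else 0) = korovkin_weight m' * cos th.
  move=> m'n; have [i ei] := frequency_surj m'n.
  rewrite (bigD1 i) //= ei eqxx big1 ?addr0 // => k ki.
  by rewrite -ei (inj_eq frequency_inj) (negbTE ki) mulr0.
rewrite pick // pick ?korovkin_weightN; first lra.
rewrite (leq_trans _ mn) //; apply/bigmax_leqP => j _.
by rewrite mxE abszN mnorm_le.
Qed.

Lemma mean_kernel : mean korovkin_kernel = 1.
Proof.
have := @mean_kernelM 0 0; rewrite korovkin_weight0 cos0 mulr1 => <-.
  congr mean; apply/funext => x; rewrite /cosine /mdot big1 ?mulr0 ?addr0 ?cos0 ?mulr1 //.
  by move=> j _; rewrite mxE mul0r.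
by have /eqP -> : mnorm (0 : 'rV[int]_d) == 0%N by rewrite mnorm_eq0.
Qed.

End Kernel.

(** * Mean squares *)

Lemma cos_ge_sqr (R : realType) (u : R) : 0 <= u -> 1 - cos u <= u ^+ 2.
Proof.
rewrite le_eqVlt => /orP[/eqP<-|u0]; first by rewrite cos0 subrr expr0n.
have [|xi] := @MVT R (@cos R) (fun x => - sin x) 0 u u0 (fun x _ => is_derive_cos x).
  by apply: continuous_subspaceT => y; apply: continuous_cos.
rewrite in_itv /= cos0 subr0 => /andP[xi0 xiu] e1.
have [|eta] := @MVT R (@sin R) (@cos R) 0 xi xi0 (fun x _ => is_derive_sin x).
  by apply: continuous_subspaceT => y; apply: continuous_sin.
rewrite in_itv /= sin0 !subr0 => _ e2.
have h : sin xi <= u.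
  by rewrite e2 (le_trans _ (ltW xiu)) // ler_piMl ?cos_le1 // ltW.
have -> : 1 - cos u = sin xi * u by rewrite -[1 - _]opprB e1; ring.
by rewrite expr2 ler_pM2r.
Qed.

(** Multiplied by sin (pi b), the sum telescopes. *)
Lemma norm_sum_cos_progression (R : realType) (a b : R) (N : nat) :
  sin (pi * b) != 0 ->
  `|\sum_(1 <= k < N.+1) cos (a - 2 * pi * k%:R * b)| <= `|sin (pi * b)|^-1.
Proof.
move=> sb0.
have sb : 0 < `|sin (pi * b)| by rewrite normr_gt0.
rewrite -(ler_pM2r sb) mulVf ?gt_eqF // -normrM.
pose T (k : nat) := sin (a - 2 * pi * k%:R * b - pi * b).
have -> : (\sum_(1 <= k < N.+1) cos (a - 2 * pi * k%:R * b)) * sin (pi * b) = (T 0%N - T N) / 2.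
  elim: N => [|N IH]; first by rewrite big_geq // mul0r subrr mul0r.
  rewrite big_nat_recr //= mulrDl IH.
  have -> : T N = sin ((a - 2 * pi * N.+1%:R * b) + pi * b).
    by rewrite /T -natr1; congr sin; ring.
  rewrite [T N.+1]/T; move: (a - _) (pi * b) => x y.
  by rewrite sinD sinB; field.
rewrite normrM [`|2^-1|]ger0_norm // ler_pdivrMr // mul1r.
apply: le_trans (ler_normB _ _) _.
have := sin_max (a - 2 * pi * 0%:R * b - pi * b); have := sin_max (a - 2 * pi * N%:R * b - pi * b).
rewrite -/(T N) -/(T 0%N); lra.
Qed.

Section MeanSquare.
Variables (R : realType) (d : nat).

(** Real trigonometric functions of frequencies m and -m need not be orthogonal,
so each i meets at most two indices i'; this is the factor 2. *)
Lemma almost_orthogonal (I : finType) (Q : pred I) (nu : I -> 'rV[int]_d)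
    (s : I -> 'rV[R]_d -> R) (b : I -> R) : injective nu ->
  (forall i, bounded_measurable (s i)) ->
  (forall i, Q i -> forall x, `|s i x| <= b i) ->
  (forall i i', nu i != nu i' -> nu i != - nu i' -> mean (fun x => s i x * s i' x) = 0) ->
  mean (fun x => (\sum_(i | Q i) s i x) ^+ 2) <= 2 * \sum_(i | Q i) b i ^+ 2.
Proof.
move=> nu_inj bs sb orth.
under eq_fun do rewrite expr2 big_distrlr /=.
have bss i i' : bounded_measurable (fun x => s i x * s i' x) by exact: bounded_measurableM.
rewrite mean_sum; last by move=> i; exact: bounded_measurable_sum.
under eq_bigr => i _ do rewrite mean_sum //.
pose c i i' : R := (b i ^+ 2 + b i' ^+ 2) / 2.
apply: le_trans (_ : \sum_(i | Q i) \sum_(i' | Q i')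
    (c i i' *+ (nu i == nu i') + c i i' *+ (nu i == - nu i')) <= _).
  apply: ler_sum => i Qi; apply: ler_sum => i' Qi'.
  have c0 : 0 <= c i i' by rewrite divr_ge0 // addr_ge0 ?sqr_ge0.
  have bound : mean (fun x => s i x * s i' x) <= c i i'.
    apply: le_trans (ler_norm _) _; apply: mean_norm_le => // x.
    rewrite normrM; apply: le_trans (_ : b i * b i' <= _).
      by apply: ler_pM => //; exact: sb.
    have := sqr_ge0 (b i - b i'); rewrite sqrrB /c -mulr_natr; lra.
  case: (boolP (nu i == nu i')) => h1.
    by rewrite mulr1n ler_wpDr // mulrn_wge0.
  case: (boolP (nu i == - nu i')) => h2.
    by rewrite mulr0n add0r mulr1n.
  by rewrite orth // addr0.
pose e i := b i ^+ 2 / 2.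
have e0 i : 0 <= e i by rewrite divr_ge0 ?sqr_ge0.
have cE i i' : c i i' = e i + e i' by rewrite /c /e mulrDl.
have P1 (i j j' : I) : nu i == nu j -> nu i == nu j' -> j = j'.
  by move=> /eqP h1 /eqP h2; apply: nu_inj; rewrite -h1 -h2.
have P2 (i j j' : I) : nu i == - nu j -> nu i == - nu j' -> j = j'.
  by move=> /eqP h1 /eqP h2; apply: nu_inj; apply: oppr_inj; rewrite -h1 -h2.
have P1' (i j j' : I) : nu j == nu i -> nu j' == nu i -> j = j'.
  by rewrite ![_ == nu i]eq_sym; exact: P1.
have P2' (i j j' : I) : nu j == - nu i -> nu j' == - nu i -> j = j'.
  by move=> /eqP h1 /eqP h2; apply: nu_inj; rewrite h1 h2.
have -> : 2 * \sum_(i | Q i) b i ^+ 2 =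
   \sum_(i | Q i) e i + \sum_(i | Q i) e i + (\sum_(i | Q i) e i + \sum_(i | Q i) e i).
  by rewrite /e -mulr_suml; field.
under eq_bigr => i _.
  under eq_bigr => i' _ do rewrite cE !mulrnDl.
  rewrite !big_split /=; over.
rewrite !big_split /= [X in (_ + X) + _ <= _]exchange_big [X in _ + (_ + X) <= _]exchange_big /=.
by apply: lerD; apply: lerD; apply: ler_sum => i _; apply: sum_at_most_one => //;
  [exact: P1|exact: P1'|exact: P2|exact: P2'].
Qed.

(** The quadratic polynomial in r given by the mean of the sum of
(r a_i - b_i)^2 is nonnegative, so its discriminant is not positive. *)
Lemma mean_cauchy_schwarz (I : finType) (a b : I -> 'rV[R]_d -> R) :
  (forall i, bounded_measurable (a i)) -> (forall i, bounded_measurable (b i)) ->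
  mean (fun x => \sum_i a i x * b i x) ^+ 2 <=
  mean (fun x => \sum_i a i x ^+ 2) * mean (fun x => \sum_i b i x ^+ 2).
Proof.
move=> ba bb.
have baa : bounded_measurable (fun x => \sum_i a i x ^+ 2).
  by apply: bounded_measurable_sum => i; exact: bounded_measurableM.
have bbb : bounded_measurable (fun x => \sum_i b i x ^+ 2).
  by apply: bounded_measurable_sum => i; exact: bounded_measurableM.
have bab : bounded_measurable (fun x => \sum_i a i x * b i x).
  by apply: bounded_measurable_sum => i; exact: bounded_measurableM.
set A := mean (fun x => \sum_i a i x ^+ 2).
set B := mean (fun x => \sum_i b i x ^+ 2).
set C := mean _.
have quad r : 0 <= r ^+ 2 * A - 2 * r * C + B.
  have b1 := bounded_measurableZ (r ^+ 2) baa.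
  have b2 := bounded_measurableZ (2 * r) bab.
  have b3 := bounded_measurableB b1 b2.
  rewrite /A /B /C -(meanZ _ baa) -(meanZ _ bab) -(meanB b1 b2) -(meanD b3 bbb).
  rewrite -[X in X <= _](mean_cst d); apply: mean_le.
  - exact: bounded_measurable_cst.
  - exact: bounded_measurableD.
  move=> x; rewrite !mulr_sumr -sumrB -big_split /=; apply: sumr_ge0 => i _.
  have := sqr_ge0 (r * a i x - b i x); congr (_ <= _); ring.
have A0 : 0 <= A.
  rewrite -[X in X <= _](mean_cst d); apply: mean_le => //; first exact: bounded_measurable_cst.
  by move=> x; apply: sumr_ge0 => i _; exact: sqr_ge0.
have [A00|An0] := eqVneq A 0; last first.
  have := quad (C / A).
  have -> : (C / A) ^+ 2 * A - 2 * (C / A) * C + B = (A * B - C ^+ 2) / A by field.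
  by rewrite pmulr_lge0 ?invr_gt0 ?lt_def ?An0 // subr_ge0.
have [->|Cn0] := eqVneq C 0; first by rewrite A00 mul0r expr0n.
(* If A = 0 the polynomial is affine in r, and this r would make it equal to -1. *)
have := quad ((B + 1) / (2 * C)).
have -> : ((B + 1) / (2 * C)) ^+ 2 * A - 2 * ((B + 1) / (2 * C)) * C + B = -1.
  by rewrite A00; field.
by rewrite oppr_ge0 ler10.
Qed.

End MeanSquare.

(** * Lipschitz functions and their Fourier coefficients *)

Section LipschitzFunction.
Local Open Scope classical_set_scope.
Variables (R : realType) (d : nat).
Local Notation "''e_' j" := (delta_mx 0 j : 'rV[R]_d) (at level 8, j at level 2).
Implicit Types (g h : 'rV[R]_d -> R) (m : 'rV[int]_d).

Variables (f : 'rV[R]_d -> R) (L : R).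
Hypothesis fp : Zperiodic f.
Hypothesis df : forall x, differentiable f x.
Hypothesis L0 : 0 <= L.
Hypothesis lip : forall x j (h : R), `|f (x + h *: 'e_j) - f x| <= L * `|h|.

Lemma lipschitz_sum x y : `|f (x + y) - f x| <= L * \sum_j `|y 0 j|.
Proof.
rewrite {1}[y]row_sum_delta.
elim: (index_enum _) => [|j s IH].
  by rewrite !big_nil addr0 subrr normr0 mulr0.
rewrite !big_cons mulrDr.
have -> : f (x + (y 0 j *: 'e_j + \sum_(i <- s) y 0 i *: 'e_i)) - f x =
  (f (x + \sum_(i <- s) y 0 i *: 'e_i + y 0 j *: 'e_j) - f (x + \sum_(i <- s) y 0 i *: 'e_i))
  + (f (x + \sum_(i <- s) y 0 i *: 'e_i) - f x).
  by rewrite [_ + \sum_(i <- s) _]addrC [x + (_ + _)]addrA; ring.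
by apply: le_trans (ler_normD _ _) _; apply: lerD.
Qed.

Lemma near_lattice (y : 'rV[R]_d) :
  exists z : 'rV[int]_d, forall j, `|y 0 j - (z 0 j)%:~R| <= 1 / 2.
Proof.
exists (\row_j xchoose (nearest_int (y 0 j))) => j.
by rewrite mxE; exact: xchooseP (nearest_int (y 0 j)).
Qed.

Lemma lipschitz_torus x y (z : 'rV[int]_d) :
  `|f (x + y) - f x| <= L * \sum_j `|y 0 j - (z 0 j)%:~R|.
Proof.
rewrite -(fp (x + y) (- z)).
have -> : x + y + map_mx intr (- z) = x + (y - map_mx intr z).
  by rewrite -addrA; congr (_ + (_ + _)); apply/rowP => j; rewrite !mxE intrN.
apply: le_trans (lipschitz_sum _ _) _; rewrite ler_wpM2l //.
by apply: ler_sum => j _; rewrite !mxE.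
Qed.

(** The increment depends only on y modulo 1, and |sin (pi y_j)| dominates the
distance from y_j to the integers.  Unlike that distance, it becomes a
trigonometric polynomial when squared. *)
Lemma lipschitz_sin x y : `|f (x + y) - f x| <= L * \sum_j `|sin (pi * y 0 j)|.
Proof.
have [z zy] := near_lattice y.
apply: le_trans (lipschitz_torus x y z) _; rewrite ler_wpM2l //.
by apply: ler_sum => j _; exact: norm_sin_pi_ge.
Qed.

Lemma lipschitz_continuous : continuous f.
Proof. by move=> x; exact: differentiable_continuous. Qed.

Lemma bounded_measurable_lipschitz : bounded_measurable f.
Proof.
split; first by apply: measurable_rv_continuous; exact: lipschitz_continuous.
exists (`|f 0| + L * \sum_(j < d) 1) => x.
rewrite -[x in f x]add0r -[f (0 + x)](subrK (f 0)) addrC.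
apply: le_trans (ler_normD _ _) _; rewrite lerD2l.
apply: le_trans (lipschitz_sin _ _) _; rewrite ler_wpM2l //.
by apply: ler_sum => j _; exact: sin_max.
Qed.

Lemma partial_bound j x : `|'D_('e_j) f x| <= L.
Proof.
have /derive_seq_cvg H := diff_derivable (v := 'e_j) (df x).
have H' := cvg_norm H _.
rewrite -(cvg_lim _ (H' _)) //; apply: limr_le; first by apply/cvg_ex; eexists; exact: H'.
apply: nearW => n /=.
rewrite normrM ger0_norm // -ler_pdivlMl // mulrC.
by apply: le_trans (lip _ _ _) _; rewrite ger0_norm ?invr_ge0.
Qed.

Lemma bounded_measurable_partial j : bounded_measurable ('D_('e_j) f).
Proof.
by split; [exact: measurable_partial|exists L; exact: partial_bound].
Qed.

Let bf := bounded_measurable_lipschitz.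
Let bD := bounded_measurable_partial.

Lemma cosineB_pihalf m (th : R) (x : 'rV[R]_d) :
  cosine m (th - pi / 2) x = sin (2 * pi * mdot m x + th).
Proof. by rewrite /cosine addrA cosBpihalf. Qed.

Lemma mean_shiftM (v : 'rV[R]_d) g : bounded_measurable g -> Zperiodic g ->
  mean (fun x => f (x + v) * g x) = mean (fun x => f x * g (x - v)).
Proof.
move=> bg gp.
have bgv := bounded_measurable_shift (- v) bg.
rewrite -(@mean_shift R d v (fun x => f x * g (x - v))) //.
- by congr mean; apply/funext => x; rewrite addrK.
- exact: bounded_measurableM.
- by move=> x z; rewrite fp addrAC gp.
Qed.

(** Integration by parts without continuity of the partial derivatives: by
translation invariance the difference quotients of f can be moved to the
cosine, and they converge boundedly on both sides. *)
Lemma mean_partial_cosine j m th :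
  mean (fun x => 'D_('e_j) f x * cosine m th x) =
  2 * pi * (m 0 j)%:~R * mean (fun x => f x * cosine m (th - pi / 2) x).
Proof.
have bc := @bounded_measurable_cosine R d.
pose A := mean (fun x => f x * cosine m th x).
pose S := mean (fun x => f x * cosine m (th - pi / 2) x).
pose c : R := 2 * pi * (m 0 j)%:~R.
pose F (h : R) : R := cos (c * h) * A + sin (c * h) * S.
have FE (h : R) : mean (fun x => f (x + h *: 'e_j) * cosine m th x) = F h.
  rewrite mean_shiftM //; last exact: Zperiodic_cosine.
  rewrite /F /A /S -!meanZ; try by apply: bounded_measurableM.
  rewrite -meanD; try by apply: bounded_measurableZ; apply: bounded_measurableM.
  congr mean; apply/funext => x.
  rewrite cosineB_pihalf /cosine -scaleNr mdotD mdot_delta.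
  have -> : 2 * pi * (mdot m x + (m 0 j)%:~R * - h) + th =
     (2 * pi * mdot m x + th) - c * h by rewrite /c; ring.
  by move: (_ + th) (c * h) => u v; rewrite cosB; ring.
have F0 : F 0 = A by rewrite /F mulr0 cos0 sin0 mul1r mul0r addr0.
have dF : is_derive (0 : R) (1 : R) F (c * S).
  apply: is_derive_eq.
  by rewrite mulr0 cos0 sin0 /GRing.scale /=; ring.
have [dF0 dFE] := dF.
have lim1 := derive_seq_cvg dF0.
rewrite dFE in lim1.
pose G n x := n.+1%:R * (f (x + n.+1%:R^-1 *: 'e_j) - f x) * cosine m th x.
have bG n : bounded_measurable (G n).
  apply: bounded_measurableM => //; apply: bounded_measurableZ.
  by apply: bounded_measurableB => //; exact: bounded_measurable_shift.
have lim2 : (fun n => mean (G n)) @ \oo --> mean (fun x => 'D_('e_j) f x * cosine m th x).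
  apply: (@mean_cvg _ _ _ _ L) => [n||n x|x].
  - by case: (bG n).
  - exact: bounded_measurableM.
  - rewrite /G normrM -[X in _ <= X]mulr1; apply: ler_pM => //; last exact: cos_max.
    rewrite normrM ger0_norm // -ler_pdivlMl // mulrC.
    by apply: le_trans (lip _ _ _) _; rewrite ger0_norm ?invr_ge0.
  have := derive_seq_cvg (diff_derivable (v := 'e_j) (df x)).
  by move=> H; apply: cvgM; [exact: H|exact: cvg_cst].
have GE : (fun n => mean (G n)) = (fun n : nat => n.+1%:R * (F (0 + n.+1%:R^-1 *: 1) - F 0)).
  apply/funext => n /=; rewrite /G.
  under [in LHS]eq_fun do rewrite -mulrA mulrBl.
  have bs : bounded_measurable (fun x => f (x + n.+1%:R^-1 *: 'e_j) * cosine m th x).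
    by apply: bounded_measurableM => //; exact: bounded_measurable_shift.
  have bt : bounded_measurable (fun x => f x * cosine m th x) by exact: bounded_measurableM.
  rewrite meanZ; last exact: bounded_measurableB.
  by rewrite meanB // FE F0 add0r [_ *: 1]mulr1.
rewrite GE in lim2.
by rewrite -(cvg_lim _ lim2) // (cvg_lim _ lim1).
Qed.

Definition sqr_norm m : R := \sum_j (m 0 j)%:~R ^+ 2.

(** The symbol of the gradient of the inverse Laplacian, up to a unit factor: it
recovers a Fourier coefficient of f from those of its partial derivatives. *)
Definition fourier_multiplier m j : R := (m 0 j)%:~R / (2 * pi * sqr_norm m).

Lemma sqr_norm_ge m : (mnorm m)%:R ^+ 2 <= sqr_norm m.
Proof.
have [m0|m0] := eqVneq m 0.
  move: (m0) => /eqP; rewrite -mnorm_eq0 => /eqP ->; rewrite expr0n.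
  by apply: sumr_ge0 => j _; exact: sqr_ge0.
have d0 : (0 < d)%N.
  by case: (d) m m0 => // m'; rewrite (_ : m' = 0) ?eqxx //; apply/rowP; case.
have [j ->] : exists j, mnorm m = `|m 0%R j|%N.
  rewrite /mnorm; have [|j ->] := @bigop.eq_bigmax _ (fun j : 'I_d => `|m 0%R j|%N).
    by rewrite card_ord.
  by exists j.
rewrite /sqr_norm (bigD1 j) //= pmulrn abszE intr_norm real_normK ?num_real //.
by rewrite lerDl; apply: sumr_ge0 => i _; exact: sqr_ge0.
Qed.

Lemma sqr_norm_gt0 m : m != 0 -> 0 < sqr_norm m.
Proof.
move=> m0; apply: lt_le_trans (sqr_norm_ge m).
by rewrite exprn_gt0 // ltr0n lt0n mnorm_eq0.
Qed.

Lemma fourier_multiplier_sqr m : m != 0 ->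
  \sum_j fourier_multiplier m j ^+ 2 <= (mnorm m)%:R ^- 2.
Proof.
move=> m0; have s0 := sqr_norm_gt0 m0.
have n0 : 0 < (mnorm m)%:R :> R by rewrite ltr0n lt0n mnorm_eq0.
have p1 : 1 <= 2 * pi :> R by have := pi_ge2 R; lra.
have -> : \sum_j fourier_multiplier m j ^+ 2 = ((2 * pi) ^+ 2 * sqr_norm m)^-1.
  rewrite /fourier_multiplier; under eq_bigr do rewrite expr_div_n.
  rewrite -mulr_suml -/(sqr_norm m).
  move: (2 * pi) p1 (sqr_norm m) s0 => w w1 s s0; field.
  by rewrite !gt_eqF // (lt_le_trans ltr01).
have w0 : 0 < 2 * pi :> R := lt_le_trans ltr01 p1.
have ws0 : 0 < (2 * pi) ^+ 2 * sqr_norm m by rewrite mulr_gt0 // exprn_gt0.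
rewrite lef_pV2 ?posrE ?(exprn_gt0 _ n0) //.
apply: le_trans (sqr_norm_ge m) _; rewrite ler_peMl ?(ltW s0) //.
by rewrite exprn_ege1.
Qed.

Lemma mean_cosine_partial m th : m != 0 ->
  mean (fun x => f x * cosine m th x) =
  mean (fun x => \sum_j 'D_('e_j) f x * (fourier_multiplier m j * cosine m (th + pi / 2) x)).
Proof.
move=> m0; have s0 := sqr_norm_gt0 m0.
have p1 : 1 <= 2 * pi :> R by have := pi_ge2 R; lra.
have bc := @bounded_measurable_cosine R d.
rewrite mean_sum; last by move=> j; apply: bounded_measurableM => //; exact: bounded_measurableZ.
under [RHS]eq_bigr => j _.
  under [in mean _]eq_fun do rewrite mulrCA.
  rewrite meanZ; last exact: bounded_measurableM.
  rewrite mean_partial_cosine addrK /fourier_multiplier; over.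
rewrite -[LHS]mul1r.
have E : 1 = \sum_j (m 0 j)%:~R / (2 * pi * sqr_norm m) * (2 * pi * (m 0 j)%:~R) :> R.
  transitivity ((sqr_norm m)^-1 * sqr_norm m); first by rewrite mulVf // gt_eqF.
  rewrite {2}/sqr_norm mulr_sumr; apply: eq_bigr => j _.
  move: (2 * pi) p1 (sqr_norm m) s0 => w w1 s s0; field.
  by rewrite !gt_eqF // (lt_le_trans ltr01).
by rewrite [X in X * _ = _]E mulr_suml; apply: eq_bigr => j _; rewrite mulrA.
Qed.

End LipschitzFunction.

(** * Smoothing and the smoothed discrepancy *)

Lemma Zperiodic_kernel (R : realType) n d : Zperiodic (@korovkin_kernel R n d).
Proof.
by move=> x z; apply: eq_bigr => k _; rewrite (Zperiodic_cosine (frequency k) 0).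
Qed.

Section Discrepancy.
Local Open Scope classical_set_scope.
Variables (R : realType) (d : nat).
Local Notation "''e_' j" := (delta_mx 0 j : 'rV[R]_d) (at level 8, j at level 2).

Variables (f : 'rV[R]_d -> R) (L : R).
Hypothesis fp : Zperiodic f.
Hypothesis df : forall x, differentiable f x.
Hypothesis L0 : 0 <= L.
Hypothesis lip : forall x j (h : R), `|f (x + h *: 'e_j) - f x| <= L * `|h|.

Let bf : bounded_measurable f := bounded_measurable_lipschitz fp df L0 lip.
Let bD : forall j, bounded_measurable ('D_('e_j) f) := bounded_measurable_partial df lip.
Let bc m th : bounded_measurable (cosine m th) := @bounded_measurable_cosine R d m th.

(** By the arithmetic-geometric inequality |s| <= (t + s^2 / t) / 2 with
t = 1/(n+2) and s = sin (pi y_j), everything reduces to the mean of the kernel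
against cos (2 pi y_j), which is the explicit coefficient cos (pi/(n+2)) =
1 - O(n^-2). *)
Lemma smoothing_error n x : (0 < n)%N ->
  `|f x - mean (fun y => f (x + y) * korovkin_kernel n y)| <= 5 * d%:R * L / n%:R.
Proof.
move=> n0.
have bk := @bounded_measurable_kernel R n d.
have bfx : bounded_measurable (fun y => f (x + y)).
  by under eq_fun do rewrite addrC; exact: bounded_measurable_shift.
have -> : f x - mean (fun y => f (x + y) * korovkin_kernel n y) =
    mean (fun y => f x * korovkin_kernel n y - f (x + y) * korovkin_kernel n y).
  rewrite meanB ?meanZ ?mean_kernel ?mulr1 //.
  - exact: bounded_measurableZ.
  - exact: bounded_measurableM.
apply: le_trans (mean_norm _) _.
  by apply: bounded_measurableB; [exact: bounded_measurableZ|exact: bounded_measurableM].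
(* The width of the kernel, as the free parameter of the arithmetic-geometric inequality. *)
pose t : R := n.+2%:R^-1.
have t0 : 0 < t by rewrite invr_gt0.
pose a : R := t / 2 + (4 * t)^-1.
pose G j (y : 'rV[R]_d) := a * korovkin_kernel n y -
  (4 * t)^-1 * (korovkin_kernel n y * cosine (delta_mx 0 j) 0 y).
have bG j : bounded_measurable (G j).
  by apply: bounded_measurableB; apply: bounded_measurableZ => //; exact: bounded_measurableM.
apply: le_trans (_ : mean (fun y => L * \sum_j G j y) <= _).
  apply: mean_le.
  - apply: bounded_measurable_norm; apply: bounded_measurableB.
      exact: bounded_measurableZ.
    exact: bounded_measurableM.
  - by apply: bounded_measurableZ; exact: bounded_measurable_sum.
  move=> y; rewrite -mulrBl normrM distrC.
  have k0 := korovkin_kernel_ge0 n y.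
  rewrite [`|korovkin_kernel n y|]ger0_norm //.
  apply: le_trans (ler_wpM2r k0 (lipschitz_sin fp L0 lip x y)) _.
  rewrite -mulrA ler_wpM2l // mulr_suml; apply: ler_sum => j _.
  have -> : G j y = (a - (4 * t)^-1 * cosine (delta_mx 0 j) 0 y) * korovkin_kernel n y.
    by rewrite /G; ring.
  rewrite ler_wpM2r //.
  have -> : cosine (delta_mx 0 j) 0 y = 1 - 2 * sin (pi * y 0 j) ^+ 2.
    have -> : cosine (delta_mx 0 j) 0 y = cos ((pi * y 0 j) *+ 2).
      rewrite /cosine addr0 /mdot (bigD1 j) //= mxE !eqxx big1 ?addr0 => [|i ij].
        by congr cos; rewrite /= mulr1z mul1r -mulrA mulr_natl.
      by rewrite mxE (negbTE ij) andbF mul0r.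
    by rewrite cos_mulr2n cos2sin2 -[_ *+ 2]mulr_natl; ring.
  set s := sin _.
  have s2 : s ^+ 2 = `|s| ^+ 2 by rewrite real_normK ?num_real.
  have -> : a - (4 * t)^-1 * (1 - 2 * s ^+ 2) = (t ^+ 2 + `|s| ^+ 2) / (2 * t).
    by rewrite s2 /a; field; rewrite gt_eqF.
  rewrite ler_pdivlMr ?mulr_gt0 //.
  by have := sqr_ge0 (t - `|s|); rewrite sqrrB -mulr_natr; lra.
rewrite meanZ; last exact: bounded_measurable_sum.
rewrite mean_sum //.
have Gle j : mean (G j) <= 5 * t.
  rewrite meanB; try (apply: bounded_measurableZ => //; exact: bounded_measurableM).
  rewrite !meanZ //; last exact: bounded_measurableM.
  rewrite mean_kernel mean_kernelM; last first.
    apply/bigmax_leqP => i _; rewrite mxE; case: (_ && _) => //.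
  rewrite korovkin_weight_delta cos0 !mulr1.
  have pt0 : 0 <= pi * t by rewrite mulr_ge0 ?pi_ge0 // ltW.
  have h1 := cos_ge_sqr pt0.
  have p4 : pi <= 4 :> R by have := @pihalf_lt2 R; lra.
  have h2 : (pi * t) ^+ 2 <= 16 * t ^+ 2.
    rewrite exprMn ler_wpM2r ?sqr_ge0 // (_ : 16 = 4 ^+ 2); last by rewrite -natrX.
    by rewrite lerXn2r ?nnegrE ?pi_ge0.
  have -> : a - (4 * t)^-1 * cos (pi / n.+2%:R) = t / 2 + (1 - cos (pi * t)) / (4 * t).
    by rewrite /a -/t; field; rewrite gt_eqF.
  have : (1 - cos (pi * t)) / (4 * t) <= 4 * t.
    rewrite ler_pdivrMr ?mulr_gt0 //; lra.
  lra.
apply: le_trans (ler_wpM2l L0 (ler_sum _ (fun j _ => Gle j))) _.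
rewrite sumr_const card_ord -[_ *+ d]mulr_natl.
have tn : t <= n%:R^-1 by rewrite lef_pV2 ?posrE ?ltr0n // ler_nat; lia.
have -> : 5 * d%:R * L / n%:R = (L * d%:R * 5) * n%:R^-1 by ring.
have -> : L * (d%:R * (5 * t)) = (L * d%:R * 5) * t by ring.
by rewrite ler_wpM2l // !mulr_ge0.
Qed.

Variables (alpha : 'rV[R]_d) (N : nat).
Hypothesis N0 : (0 < N)%N.

(** The phase makes the summands sin (2 pi m.(k alpha - y)). *)
Definition orbit_cosine m (y : 'rV[R]_d) : R :=
  N%:R^-1 * \sum_(1 <= k < N.+1) cosine m (- (2 * pi * k%:R * mdot m alpha) + pi / 2) y.

Lemma bounded_measurable_orbit_cosine m : bounded_measurable (orbit_cosine m).
Proof. by apply: bounded_measurableZ; exact: bounded_measurable_sum. Qed.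

Lemma orbit_cosine_bound m y : sin (pi * mdot m alpha) != 0 ->
  `|orbit_cosine m y| <= (N%:R * `|sin (pi * mdot m alpha)|)^-1.
Proof.
move=> s0; rewrite invfM normrM ger0_norm ?invr_ge0 // ler_wpM2l ?invr_ge0 //.
rewrite (eq_bigr (fun k => cos ((2 * pi * mdot m y + pi / 2) - 2 * pi * k%:R * mdot m alpha))).
  exact: norm_sum_cos_progression.
by move=> k _; rewrite /cosine; congr cos; ring.
Qed.

Lemma orbit_cosine_orthogonal m m' : m != m' -> m != - m' ->
  mean (fun y => orbit_cosine m y * orbit_cosine m' y) = 0.
Proof.
move=> h1 h2; rewrite /orbit_cosine.
under eq_fun do rewrite mulrACA big_distrlr /=.
have bcc m1 m2 t1 t2 : bounded_measurable (fun y : 'rV[R]_d => cosine m1 t1 y * cosine m2 t2 y).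
  exact: bounded_measurableM.
rewrite meanZ; last by apply: bounded_measurable_sum => k; exact: bounded_measurable_sum.
rewrite mean_sum; last by move=> k; exact: bounded_measurable_sum.
rewrite big1 ?mulr0 // => k _; rewrite mean_sum // big1 // => l _.
by rewrite mean_cosineM (negbTE h1) (negbTE h2) addr0 mulr0.
Qed.

Variable n : nat.
Local Notation freq := (@frequency n d).
Local Notation w k := (korovkin_weight R n (freq k)).

(** The vector field u with div u = 1 - nu, where nu is the average over
k = 1, ..., N of the kernel translated to k alpha. *)
Definition potential (j : 'I_d) (y : 'rV[R]_d) : R :=
  \sum_(k | freq k != 0)
    w k * fourier_multiplier R (freq k) j * orbit_cosine (freq k) y.

Lemma bounded_measurable_potential j : bounded_measurable (potential j).
Proof.
apply: bounded_measurable_sum => k; apply: bounded_measurableZ.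
exact: bounded_measurable_orbit_cosine.
Qed.

(** The Fourier expansion of the smoothed function at k alpha, each nonconstant
coefficient being rewritten in terms of the partial derivatives. *)
Lemma mean_kernel_shift k : mean (fun y => f (k%:R *: alpha + y) * korovkin_kernel n y) =
  mean f + \sum_(i | freq i != 0) w i *
    mean (fun y => \sum_j 'D_('e_j) f y * (fourier_multiplier R (freq i) j *
      cosine (freq i) (- (2 * pi * k%:R * mdot (freq i) alpha) + pi / 2) y)).
Proof.
under eq_fun do rewrite addrC.
rewrite (mean_shiftM fp df L0 lip); last 2 first.
- exact: bounded_measurable_kernel.
- exact: Zperiodic_kernel.
have kE y : korovkin_kernel n (y - k%:R *: alpha) =
    \sum_i w i * cosine (freq i) (- (2 * pi * k%:R * mdot (freq i) alpha)) y.
  apply: eq_bigr => i _; congr (_ * _); rewrite /cosine mdotD.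
  have -> : mdot (freq i) (- (k%:R *: alpha)) = - (k%:R * mdot (freq i) alpha).
    rewrite /mdot mulr_sumr -sumrN; apply: eq_bigr => j _; rewrite !mxE; ring.
  by congr cos; ring.
under eq_fun do rewrite kE mulr_sumr.
rewrite mean_sum; last by move=> i; apply: bounded_measurableM => //; exact: bounded_measurableZ.
under eq_bigr => i _.
  under [in mean _]eq_fun do rewrite mulrCA.
  rewrite meanZ; last exact: bounded_measurableM.
  over.
have [i0 ei0] : exists i, freq i = 0.
  by apply: frequency_surj; have /eqP -> : mnorm (0 : 'rV[int]_d) == 0%N by rewrite mnorm_eq0.
rewrite (bigD1 i0) //=; congr (_ + _).
  rewrite ei0 korovkin_weight0 mul1r; congr mean; apply/funext => y.
  have m0 z : mdot (0 : 'rV[int]_d) z = 0 :> R by rewrite /mdot big1 // => j _; rewrite mxE mul0r.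
  by rewrite /cosine !m0 !mulr0 oppr0 addr0 cos0 mulr1.
rewrite (eq_bigl (fun i => freq i != 0)) => [|i]; last first.
  by rewrite -ei0 (inj_eq (@frequency_inj n d)).
by apply: eq_bigr => i fi0; rewrite (mean_cosine_partial fp df L0 lip _ fi0).
Qed.

Lemma smoothed_discrepancy :
  N%:R^-1 * (\sum_(1 <= k < N.+1) mean (fun y => f (k%:R *: alpha + y) * korovkin_kernel n y))
  - mean f = mean (fun y => \sum_j 'D_('e_j) f y * potential j y).
Proof.
pose T k i j (y : 'rV[R]_d) := 'D_('e_j) f y * (fourier_multiplier R (freq i) j *
      cosine (freq i) (- (2 * pi * k%:R * mdot (freq i) alpha) + pi / 2) y).
have bT k (i) j : bounded_measurable (T k i j).
  by apply: bounded_measurableM => //; exact: bounded_measurableZ.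
have NR : N%:R != 0 :> R by rewrite pnatr_eq0 -lt0n.
under eq_bigr => k _ do rewrite mean_kernel_shift.
rewrite big_split /= sumr_const_nat subn1 /= mulrDr -[mean f *+ N]mulr_natl mulKf //.
rewrite addrAC subrr add0r.
transitivity (mean (fun y => N%:R^-1 * \sum_(1 <= k < N.+1) \sum_(i | freq i != 0) w i *
   \sum_j T k i j y)).
  rewrite meanZ; last first.
    apply: bounded_measurable_sum => k; apply: bounded_measurable_sum => i.
    by apply: bounded_measurableZ; exact: bounded_measurable_sum.
  rewrite mean_sum; last first.
    move=> k; apply: bounded_measurable_sum => i.
    by apply: bounded_measurableZ; exact: bounded_measurable_sum.
  congr (_ * _); apply: eq_bigr => k _.
  rewrite mean_sum; last first.
    by move=> i; apply: bounded_measurableZ; exact: bounded_measurable_sum.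
  by apply: eq_bigr => i _; rewrite meanZ //; exact: bounded_measurable_sum.
congr mean; apply/funext => y.
rewrite /potential /orbit_cosine.
transitivity (\sum_(1 <= k < N.+1) \sum_(i | freq i != 0) \sum_j N%:R^-1 * (w i * T k i j y)).
  rewrite mulr_sumr; apply: eq_bigr => k _; rewrite mulr_sumr; apply: eq_bigr => i _.
  by rewrite !mulr_sumr.
transitivity (\sum_j \sum_(i | freq i != 0) \sum_(1 <= k < N.+1) N%:R^-1 * (w i * T k i j y)).
  rewrite exchange_big /= [RHS]exchange_big /=; apply: eq_bigr => i _.
  by rewrite exchange_big.
apply: eq_bigr => j _; rewrite mulr_sumr; apply: eq_bigr => i _.
rewrite !mulr_sumr; apply: eq_bigr => k _; rewrite /T; ring.
Qed.

(** Orthogonality reduces the energy to the amplitudes of the modes; the geometric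
sum over the orbit gives 1/(N |sin (pi m.alpha)|), and summing the squared
multipliers over the coordinates gives |m|^-2. *)
Lemma potential_energy : (forall m, m != 0 -> sin (pi * mdot m alpha) != 0) ->
  mean (fun y => \sum_j potential j y ^+ 2) <=
  2 / N%:R ^+ 2 * \sum_(k | freq k != 0)
     ((mnorm (freq k))%:R * `|sin (pi * mdot (freq k) alpha)|) ^- 2.
Proof.
move=> s0.
have bp := bounded_measurable_potential.
rewrite mean_sum; last by move=> j; exact: bounded_measurableM.
pose D k : R := (N%:R * `|sin (pi * mdot (freq k) alpha)|)^-1.
have pj j : mean (fun y => potential j y ^+ 2) <=
    2 * \sum_(k | freq k != 0)
      (`|fourier_multiplier R (freq k) j| * D k) ^+ 2.
  apply: almost_orthogonal; first exact: frequency_inj.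
  - by move=> k; apply: bounded_measurableZ; exact: bounded_measurable_orbit_cosine.
  - move=> k k0 y; rewrite normrM; apply: ler_pM => //.
    + by rewrite normrM ler_piMl // korovkin_weight_norm_le1.
    by apply: orbit_cosine_bound; exact: s0.
  - move=> k k' h1 h2; under eq_fun do rewrite mulrACA.
    rewrite meanZ ?orbit_cosine_orthogonal ?mulr0 //.
    by apply: bounded_measurableM; exact: bounded_measurable_orbit_cosine.
apply: le_trans (ler_sum _ (fun j _ => pj j)) _.
rewrite -mulr_sumr exchange_big /= -[X in _ <= X]mulrA ler_wpM2l // mulr_sumr.
apply: ler_sum => k k0.
under eq_bigr do rewrite exprMn real_normK ?num_real //.
have := fourier_multiplier_sqr R k0.
rewrite -mulr_suml /D; set A := \sum_j _; set b := (mnorm _)%:R; set c := `|_| => Ab.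
have -> : (N%:R * c)^-1 ^+ 2 = N%:R ^- 2 * c ^- 2 by rewrite exprVn exprMn invfM.
have -> : (b * c) ^- 2 = b ^- 2 * c ^- 2 by rewrite exprMn invfM.
rewrite [X in _ <= X]mulrCA ler_wpM2r // mulr_ge0 // invr_ge0 exprn_ge0 //.
exact: normr_ge0.
Qed.

End Discrepancy.

(** * Choice of the scale and norms of the gradient *)

Section DiscrepancyBound.
Variables (R : realType) (d : nat).
Local Notation "''e_' j" := (delta_mx 0 j : 'rV[R]_d) (at level 8, j at level 2).

Variables (f : 'rV[R]_d -> R) (L : R).
Hypothesis fp : Zperiodic f.
Hypothesis df : forall x, differentiable f x.
Hypothesis L0 : 0 <= L.
Hypothesis lip : forall x j (h : R), `|f (x + h *: 'e_j) - f x| <= L * `|h|.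

Variables (alpha : 'rV[R]_d) (c : R).
Hypothesis d1 : (1 < d)%N.
Hypothesis c0 : 0 < c.
Hypothesis dioph : forall (m : 'rV[int]_d) (X : nat) (m0 : int),
    m != 0 -> (forall j, `|m 0%R j| <= X)%N ->
    c / X%:R ^+ d <= `|mdot m alpha - m0%:~R|.

Lemma sin_pi_mdot_neq0 (m : 'rV[int]_d) : m != 0 -> sin (pi * mdot m alpha) != 0.
Proof.
move=> m0; have [z zP] := nearest_int (mdot m alpha).
rewrite -normr_gt0; apply: lt_le_trans (norm_sin_pi_ge zP).
apply: lt_le_trans (dioph z m0 (mnorm_le m)).
by rewrite divr_gt0 // exprn_gt0 // ltr0n lt0n mnorm_eq0.
Qed.

Lemma discrepancy_bound (N p : nat) : (0 < N)%N ->
  `|mean f - N%:R^-1 * \sum_(1 <= k < N.+1) f (k%:R *: alpha)| <=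
  5 * d%:R * L / 2 ^+ p +
  Num.sqrt (mean (fun x => \sum_j ('D_('e_j) f x) ^+ 2)) *
  (Num.sqrt (2 * (4 * 4 ^+ (2 * d) / c ^+ 2)) * (2 ^+ p) ^+ d.-1 / N%:R).
Proof.
move=> N0; pose n := (2 ^ p)%N.
have n0 : (0 < n)%N by rewrite expn_gt0.
have nR : n%:R = 2 ^+ p :> R by rewrite natrX.
have NR : 0 < N%:R :> R by rewrite ltr0n.
pose S k := mean (fun y => f (k%:R *: alpha + y) * korovkin_kernel n y).
pose E := N%:R^-1 * \sum_(1 <= k < N.+1) f (k%:R *: alpha).
pose E' := N%:R^-1 * \sum_(1 <= k < N.+1) S k.
set A := mean (fun x => \sum_j _); set K := 4 * _ / c ^+ 2.
have -> : mean f - E = (E' - E) - (E' - mean f) by ring.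
apply: le_trans (ler_normB _ _) _; apply: lerD.
  rewrite -mulrBr -sumrB normrM ger0_norm ?invr_ge0 // mulrC ler_pdivrMr //.
  apply: le_trans (ler_norm_sum _ _ _) _.
  apply: le_trans (_ : \sum_(1 <= k < N.+1) 5 * d%:R * L / n%:R <= _).
    by apply: ler_sum => k _; rewrite distrC; exact: smoothing_error.
  by rewrite sumr_const_nat subn1 /= nR -[_ *+ N]mulr_natr.
rewrite /E' /S (smoothed_discrepancy fp df L0 lip alpha N0 n).
have bD : forall j, bounded_measurable ('D_('e_j) f) := bounded_measurable_partial df lip.
have bp := @bounded_measurable_potential R d alpha N n.
have energy := @potential_energy R d alpha N n sin_pi_mdot_neq0.
have CS := mean_cauchy_schwarz bD bp.
rewrite -sqrtr_sqr; apply: le_trans (ler_wsqrtr CS) _.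
have A0 : 0 <= A.
  rewrite -[X in X <= _](mean_cst d); apply: mean_le.
  - exact: bounded_measurable_cst.
  - by apply: bounded_measurable_sum => j; exact: bounded_measurableM.
  by move=> x; apply: sumr_ge0 => j _; exact: sqr_ge0.
rewrite sqrtrM // ler_wpM2l ?sqrtr_ge0 //.
have K0 : 0 <= 2 * K by rewrite !mulr_ge0 ?invr_ge0 ?exprn_ge0 // ltW.
have -> : Num.sqrt (2 * K) * (2 ^+ p) ^+ d.-1 / N%:R =
    Num.sqrt (2 * K * ((2 ^+ p) ^+ d.-1 / N%:R) ^+ 2).
  by rewrite [RHS](sqrtrM _ K0) sqrtr_sqr ger0_norm ?mulrA // divr_ge0 ?exprn_ge0.
apply: ler_wsqrtr; apply: le_trans energy _.
have sd := @sum_small_denominators R d alpha c c0 dioph _ _ (@frequency_inj n d) p d1.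
rewrite -/K in sd.
rewrite (eq_bigl (fun k => (0 < mnorm (frequency k) <= 2 ^ p)%N)); last first.
  by move=> k; rewrite lt0n mnorm_eq0 frequency_norm andbT.
apply: le_trans (ler_wpM2l _ sd) _; first by rewrite divr_ge0 ?exprn_ge0.
have e2 : (2 * d - 2 = d.-1 * 2)%N by lia.
rewrite e2 [_ ^+ (d.-1 * 2)]exprM expr_div_n.
by rewrite le_eqVlt; apply/orP; left; apply/eqP; ring.
Qed.

End DiscrepancyBound.

(** Choose 2^p within a factor 2 above r = (L N / M)^(1/d), for which
L / r = M r^(d-1) / N is the right-hand side; the hypothesis M <= L makes r >= 1,
so that such a p exists. *)
Lemma optimize_scale (R : realType) (d N : nat) (L M C1 C2 E : R) :
  (1 < d)%N -> (0 < N)%N -> 0 <= M -> M <= L -> 0 <= C1 -> 0 <= C2 ->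
  (forall p, E <= C1 * L / 2 ^+ p + M * (C2 * (2 ^+ p) ^+ d.-1 / N%:R)) ->
  E <= (C1 + 2 ^+ d.-1 * C2) *
    (L `^ ((d%:R - 1) / d%:R) * M `^ (d%:R^-1) * N%:R `^ (- d%:R^-1)).
Proof.
move=> d1 N0 M0 ML C10 C20 HE.
have L0 : 0 <= L by apply: le_trans ML.
have NR : 1 <= N%:R :> R by rewrite ler1n.
have NR0 : 0 < N%:R :> R by rewrite ltr0n.
have dR : 0 < d%:R :> R by rewrite ltr0n; lia.
(* For M = 0 only the first term of the bound is present: let p tend to infinity. *)
have [M00|Mn0] := eqVneq M 0.
  have E0 : E <= 0.
    apply/ler_addgt0Pr => e e0; rewrite add0r.
    pose p := Num.truncn (C1 * L / e).
    have := HE p; rewrite M00 mul0r addr0 => h; apply: le_trans h _.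
    rewrite ler_pdivrMr ?exprn_gt0 // [e * _]mulrC -ler_pdivrMr //.
    have CLe : 0 <= C1 * L / e by rewrite !mulr_ge0 // invr_ge0 ltW.
    apply: le_trans (ltW (andP (Num.Theory.truncn_itv CLe)).2) _.
    by rewrite -natrX ler_nat ltn_expl.
  apply: le_trans E0 _; rewrite mulr_ge0 ?addr_ge0 ?mulr_ge0 ?exprn_ge0 ?powR_ge0 //.
have Mgt0 : 0 < M by rewrite lt_def Mn0.
have Lgt0 : 0 < L by exact: lt_le_trans ML.
pose x := L * N%:R / M.
have x1 : 1 <= x.
  rewrite /x ler_pdivlMr // mul1r; apply: le_trans ML _.
  by rewrite ler_peMr.
have x0 : 0 < x by apply: lt_le_trans x1.
pose r := x `^ (d%:R^-1).
have r0 : 0 < r by exact: powR_gt0.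
have r1 : 1 <= r.
  have di : 0 <= d%:R^-1 :> R by rewrite invr_ge0 ltW.
  have := ge0_ler_powR di _ _ x1; rewrite powR1 !nnegrE ler01 (ltW x0).
  by apply.
have rd : r ^+ d = x.
  by rewrite -powR_mulrn ?powR_ge0 // -powRrM mulVf ?gt_eqF // powRr1 ?ltW.
have [p rp pr] : exists2 p, r <= 2 ^+ p & 2 ^+ p <= 2 * r.
  have ex : exists p, r <= 2 ^+ p.
    exists (Num.truncn r).
    apply: le_trans (ltW (andP (Num.Theory.truncn_itv (ltW r0))).2) _.
    by rewrite -natrX ler_nat ltn_expl.
  case: (ex_minnP ex) => -[|p] rp min; first by exists 0%N => //; lra.
  exists p.+1 => //; rewrite exprS ler_pM2l //.
  by rewrite leNgt; apply/negP => /ltW /min; rewrite ltnn.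
apply: le_trans (HE p) _.
have p0 : 0 < 2 ^+ p :> R by rewrite exprn_gt0.
have main : L `^ ((d%:R - 1) / d%:R) * M `^ (d%:R^-1) * N%:R `^ (- d%:R^-1) = L / r.
  rewrite /r /x -powRN !powRM ?invr_ge0 // ?mulr_ge0 //.
  rewrite -[M^-1]powR_inv1 // -powRrM mulN1r opprK.
  have -> : (d%:R - 1) / d%:R = 1 + - d%:R^-1 :> R by field; rewrite gt_eqF.
  rewrite powRD; last by apply/implyP => _; rewrite gt_eqF.
  by rewrite powRr1 // !mulrA mulrAC.
rewrite main mulrDl; apply: lerD.
  by rewrite -!mulrA ler_wpM2l // ler_wpM2l // lef_pV2.
have -> : L / r = M / N%:R * r ^+ d.-1.
  have : r ^+ d = r * r ^+ d.-1 by rewrite -[in LHS](prednK (ltnW d1)) exprS.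
  rewrite rd /x => h.
  have -> : L = (r * r ^+ d.-1) * M / N%:R by rewrite -h; field; rewrite !gt_eqF.
  by field; rewrite !gt_eqF.
have : (2 ^+ p) ^+ d.-1 <= 2 ^+ d.-1 * r ^+ d.-1.
  by rewrite -exprMn lerXn2r ?nnegrE ?mulr_ge0 // ltW.
have MC : 0 <= M * C2 / N%:R by rewrite !mulr_ge0 // invr_ge0 ltW.
move=> /(ler_wpM2l MC) h.
have -> : M * (C2 * (2 ^+ p) ^+ d.-1 / N%:R) = M * C2 / N%:R * (2 ^+ p) ^+ d.-1 by ring.
by apply: le_trans h _; rewrite le_eqVlt; apply/orP; left; apply/eqP; ring.
Qed.

Section GradientNorms.
Variables (R : realType) (d : nat) (f : 'rV[R]_d -> R).
Local Notation P := (torus_measure R d).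
Local Notation rv := (@rv_of_tuple R d).
Local Notation "''e_' j" := (delta_mx 0 j : 'rV[R]_d) (at level 8, j at level 2).
Hypothesis df : forall x, differentiable f x.

Let G t : R := euclidean_norm (gradient f (rv t)).

Lemma sqr_euclidean_gradient t : G t ^+ 2 = \sum_j 'D_('e_j) f (rv t) ^+ 2.
Proof.
rewrite sqr_sqrtr; last by apply: sumr_ge0 => j _; exact: sqr_ge0.
by apply: eq_bigr => j _; rewrite gradientE.
Qed.

Lemma partial_le_gradient j t : `|'D_('e_j) f (rv t)| <= G t.
Proof.
rewrite -sqrtr_sqr; apply: ler_wsqrtr; rewrite (bigD1 j) //= gradientE.
by rewrite lerDl; apply: sumr_ge0 => i _; exact: sqr_ge0.
Qed.

Lemma measurable_gradient_norm : measurable_fun setT G.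
Proof.
apply: (@measurableT_comp _ _ _ _ _ _ (@Num.sqrt R)).
  by apply: continuous_measurable_fun; exact: sqrt_continuous.
rewrite (_ : (fun t => _) = (fun t => \sum_(j <- enum 'I_d) 'D_('e_j) f (rv t) ^+ 2)).
  by apply: measurable_sum => j; apply: measurable_funX; exact: measurable_partial.
by apply/funext => t; rewrite big_enum; apply: eq_bigr => j _; rewrite gradientE.
Qed.

Lemma gradient_LnormyE : gradient_Lnorm +oo f = ess_sup P (EFin \o G).
Proof.
rewrite /gradient_Lnorm unlock [X in (0 < X)%E](@probability_setT _ _ _ P) lte01.
congr ess_sup.
by apply/funext => t /=; rewrite ger0_norm ?sqrtr_ge0.
Qed.

Lemma gradient_Lnorm2E :
  (gradient_Lnorm 2%:E f = (\int[P]_t (G t ^+ 2)%:E) `^ 2^-1)%E.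
Proof.
rewrite /gradient_Lnorm unlock; congr (_ `^ _)%E; apply: eq_integral => t _ /=.
by rewrite ger0_norm ?sqrtr_ge0 // powR_mulrn ?sqrtr_ge0.
Qed.

End GradientNorms.

Theorem theorem6 (R : realType) (d : nat) (hd : (2 <= d)%N)
    (alpha : 'rV[R]_d) (halpha : badly_approximable alpha) :
  exists2 c : R, 0 < c &
    forall f : 'rV[R]_d -> R, Zperiodic f -> (forall x, differentiable f x) ->
    forall N : nat, (1 <= N)%N ->
    (`| \int[torus_measure R d]_t (f (rv_of_tuple t))%:E
        - (N%:R^-1 * \sum_(1 <= k < N.+1) f (k%:R *: alpha))%:E |
     <= c%:E * gradient_Lnorm +oo f `^ ((d%:R - 1) / d%:R)
        * gradient_Lnorm 2%:E f `^ (d%:R^-1) * (N%:R `^ (- d%:R^-1))%:E)%E.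
Proof.
have [c c0 dioph] := transference halpha.
pose C2 : R := Num.sqrt (2 * (4 * 4 ^+ (2 * d) / c ^+ 2)).
pose C : R := 5 * d%:R + 2 ^+ d.-1 * C2.
have d0 : 0 < d%:R :> R by rewrite ltr0n; lia.
have C20 : 0 <= C2 by exact: sqrtr_ge0.
have C0 : 0 < C by rewrite ltr_pwDl ?mulr_gt0 // mulr_ge0 ?exprn_ge0.
exists C => // f fp df N N1.
have mG := measurable_gradient_norm df.
have e1 : 0 < (d%:R - 1) / d%:R :> R.
  by rewrite divr_gt0 // subr_gt0 ltr1n.
have N0 : 0 < N%:R `^ (- d%:R^-1) :> R by rewrite powR_gt0 // ltr0n.
have Ly0 : (0 <= gradient_Lnorm +oo f)%E by exact: Lnorm_ge0.
have L20 : (0 <= gradient_Lnorm 2%:E f)%E by exact: Lnorm_ge0.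
have aeL := ess_sup_ge (torus_measure R d)
  (EFin \o (fun t => euclidean_norm (gradient f (rv_of_tuple t)))).
rewrite -gradient_LnormyE in aeL.
case EL : (gradient_Lnorm +oo f) Ly0 aeL => [L||] //.
  rewrite lee_fin => L0 aeL.
  have aeD j : {ae torus_measure R d, forall t,
      `|'D_(delta_mx 0 j : 'rV[R]_d) f (rv_of_tuple t)| <= L}.
    apply: filterS aeL => t /=; rewrite lee_fin; apply: le_trans.
    exact: partial_le_gradient.
  have lip x (j : 'I_d) (h : R) : `|f (x + h *: delta_mx 0 j) - f x| <= L * `|h|.
    have [h0|h0] := leP 0 h.
      by rewrite [`|h|]ger0_norm //; exact: (partial_increment_le fp df (aeD j) x h0).
    have h1 : 0 <= - h by rewrite oppr_ge0 ltW.
    have := partial_increment_le fp df (aeD j) (x + h *: delta_mx 0 j) h1.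
    by rewrite scaleNr addrK distrC [`|h|]ltr0_norm.
  have bf := bounded_measurable_lipschitz fp df L0 lip.
  have bD := bounded_measurable_partial df lip.
  pose q (x : 'rV[R]_d) := \sum_j 'D_(delta_mx 0 j : 'rV[R]_d) f x ^+ 2.
  have bq : bounded_measurable q.
    by apply: bounded_measurable_sum => j; exact: bounded_measurableM.
  have meanE g : bounded_measurable g ->
      (\int[torus_measure R d]_t (g (rv_of_tuple t))%:E = (mean g)%:E)%E.
    move=> bg; rewrite /mean /Rintegral fineK //.
    exact: (integrable_fin_num measurableT (bounded_measurable_integrable bg)).
  have qE : (\int[torus_measure R d]_t
      ((euclidean_norm (gradient f (rv_of_tuple t)) ^+ 2)%:E) = (mean q)%:E)%E.
    by rewrite -meanE //; apply: eq_integral => t _; rewrite sqr_euclidean_gradient.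
  have q0 : 0 <= mean q.
    rewrite -lee_fin -qE; apply: integral_ge0 => t _; rewrite lee_fin; exact: sqr_ge0.
  have qL : mean q <= L ^+ 2.
    rewrite -lee_fin -qE.
    have -> : ((L ^+ 2)%:E = \int[torus_measure R d]_t (L ^+ 2)%:E)%E.
      rewrite integral_cst // [X in (_ * X)%E](@probability_setT _ _ _ (torus_measure R d)).
      by rewrite mule1.
    apply: ae_ge0_le_integral => //.
    - by move=> t _; rewrite lee_fin; exact: sqr_ge0.
    - by apply/measurable_EFinP; exact: measurable_funX.
    - by move=> t _; rewrite lee_fin; exact: sqr_ge0.
    - apply: filterS aeL => t /= + _; rewrite !lee_fin => h.
      by rewrite lerXn2r ?nnegrE ?sqrtr_ge0.
  have -> : gradient_Lnorm 2%:E f = (Num.sqrt (mean q))%:E.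
    by rewrite gradient_Lnorm2E qE poweR_EFin powR12_sqrt.
  rewrite meanE // -EFinB !poweR_EFin -!EFinM lee_fin -!mulrA [X in _ <= C * X]mulrA.
  apply: (@optimize_scale _ _ _ _ _ (5 * d%:R) C2) => // [|p].
    by rewrite -[L](ger0_norm L0) -sqrtr_sqr ler_wsqrtr.
  exact: (discrepancy_bound fp df L0 lip hd c0 dioph p N1).
move=> _ _.
rewrite poweRyr; last by rewrite gt_eqF.
rewrite gt0_muley ?lte_fin //.
(* The L-infinity norm is infinite, but a product with a zero L2 norm would be 0. *)
have [M0|Mn0] := eqVneq (gradient_Lnorm 2%:E f) 0%E; last first.
  have Mgt0 : (0 < gradient_Lnorm 2%:E f)%E by rewrite lt_def Mn0.
  by rewrite gt0_mulye ?poweR_gt0 // gt0_mulye ?lte_fin // leey.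
exfalso.
have mE : measurable_fun setT (EFin \o @euclidean_norm R d \o gradient f \o @rv_of_tuple R d).
  by apply/measurable_EFinP.
have ae0 := Lnorm_eq0_eq0 mE (ltr0n _ 2 : (0 < 2%:E)%E) M0.
have : (gradient_Lnorm +oo f <= 0)%E.
  rewrite gradient_LnormyE; apply/ess_supP.
  by apply: filterS ae0 => t /(_ Logic.I) /= ->.
by rewrite EL.
Qed.
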